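(* Let $\alpha,\beta>0$ with $\alpha+\beta<1$. There is a constant $C>0$ such that, whenever $f$ and $g\ge 0$ satisfy, for a.e. $x,y\in X$, $$|f(x)-f(y)|\le d(x,y)^\beta\,(g(x)+g(y)),$$ and $J_\alpha f$ is well defined a.e., then for a.e. $x,y\in X$ $$|J_\alpha f(x)-J_\alpha f(y)|\le C\,d(x,y)^{\alpha+\beta}\,(Mg(x)+Mg(y)).$$ In particular, if $p>1$, $J_\alpha$ is a continuous linear operator from $M^{\beta,p}$ to $M^{\alpha+\beta,p}$.
   Context: Setting: $(X,d,m)$ is a metric space with a Borel measure $m$ such that $m(X)=\infty$ and, for some $N>0$ (Ahlfors $N$-regularity), $c^{-1}r^N\le m(B(x,r))\le c\,r^N$ for all $x\in X$, $r>0$, with $c$ independent of $x,r$. Approximation of the identity: fix a non-negative decreasing $C^\infty$ function $h:[0,\infty)\to\mathbb{R}$ with $h\equiv1$ on $[0,1/2]$ and $h\equiv0$ on $[2,\infty)$. For $t>0$ let $T_tf(x)=t^{-N}\int_X h(d(x,y)/t)f(y)\,dm(y)$, $\varphi(x,t)=1/T_t1(x)$, $\psi(x,t)=1/T_t\left(\frac{1}{T_t1}\right)(x)$, and $$s(x,y,t)=\frac{\varphi(x,t)\varphi(y,t)}{t^{2N}}\int_X h\left(\tfrac{d(x,z)}{t}\right)h\left(\tfrac{d(y,z)}{t}\right)\psi(z,t)\,dm(z).$$ Bessel potential: for $\alpha>0$, $k_\alpha(x,y)=\alpha\int_0^\infty\frac{t^\alpha}{(1+t^\alpha)^2}s(x,y,t)\frac{dt}{t}$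 and $J_\alpha g(x)=\int_X g(z)k_\alpha(x,z)\,dm(z)$ (well defined at $x$ if the integral converges absolutely). $Mg(x)=\sup_{r>0}\frac{1}{m(B(x,r))}\int_{B(x,r)}|g|\,dm$ is the Hardy–Littlewood maximal function. Hajłasz–Sobolev spaces: a nonnegative $g$ is a $\beta$-Hajłasz gradient of $f$ if $|f(x)-f(y)|\le d(x,y)^\beta(g(x)+g(y))$ for a.e. $x,y$. For $1\le p\le\infty$, $M^{\beta,p}$ is the space of $f\in L^p$ having a $\beta$-Hajłasz gradient in $L^p$, with norm $\|f\|_{M^{\beta,p}}=\|f\|_p+\inf_g\|g\|_p$, the infimum over all $\beta$-Hajłasz gradients $g$ of $f$. *)

(* Defs.v *)
From HB Require Import structures.
From mathcomp Require Import all_boot all_order all_algebra.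
From mathcomp Require Import all_classical all_reals all_analysis.

Set Implicit Arguments.
Unset Strict Implicit.
Unset Printing Implicit Defensive.

Import Order.TTheory GRing.Theory Num.Theory.
Import numFieldNormedType.Exports.

Local Open Scope classical_set_scope.
Local Open Scope ring_scope.

(* Metric spaces with their Borel sigma-algebra, so that a Borel measure on X
   is just a {measure set X -> \bar R}. *)
HB.mixin Record Metric_isBorel (d : measure_display) (R : realType) X
    & Metric R X & Measurable d X := {
  borel_measurableE : @measurable d X = <<s @open X >>
}.

#[short(type="borelMetricType")]
HB.structure Definition BorelMetric (d : measure_display) (R : realType) :=
  { X of Metric R X & Measurable d X & Metric_isBorel d R X }.

(* Smoothness on [0, +oo[ is only required on ]0, +oo[: as h is constant on
   [0, 1/2], one-sided smoothness at 0 is automatic. The values of h on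
   ]-oo, 0[ are never used. *)
Definition smooth_cutoff (R : realType) (h : R -> R) : Prop :=
  [/\ forall u : R, 0 <= u -> 0 <= h u,
      forall u v : R, 0 <= u -> u <= v -> h v <= h u,
      forall (n : nat) (u : R), 0 < u -> derivable (derive1n n h) u 1,
      forall u : R, 0 <= u <= 2^-1 -> h u = 1 &
      forall u : R, 2 <= u -> h u = 0].

Section metric_measure_space.
Context {d : measure_display} {R : realType} {X : borelMetricType d R}.
Implicit Types (m : {measure set X -> \bar R}) (f g : X -> R) (x y z : X).

Definition ahlfors_regular m (N : R) : Prop :=
  exists2 c : R, 0 < c & forall x (r : R), 0 < r ->
    ((c^-1 * r `^ N)%:E <= m (ball x r))%E /\
    (m (ball x r) <= (c * r `^ N)%:E)%E.

(* "P x y for a.e. x, y": P holds outside a null set of points of X. *)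
Definition ae_pair m (P : X -> X -> Prop) : Prop :=
  exists2 E : set X, m.-negligible E & forall x y, ~ E x -> ~ E y -> P x y.

Definition maximal_function m g x : \bar R :=
  ereal_sup [set ((m (ball x r))^-1 * \int[m]_(y in ball x r) `|(g y)%:E|)%E
            | r in `]0, +oo[%classic].

Section bessel.
Variables (m : {measure set X -> \bar R}) (N : R) (h : R -> R).

Definition approx_id (t : R) f x : R :=
  t `^ (- N) * \int[m]_y (h (mdist x y / t) * f y).

Definition approx_phi x (t : R) : R := (approx_id t (fun=> 1) x)^-1.

Definition approx_psi x (t : R) : R :=
  (approx_id t (fun y => (approx_id t (fun=> 1) y)^-1) x)^-1.

Definition approx_kernel x y (t : R) : R :=
  approx_phi x t * approx_phi y t / t `^ (2 * N) *
  \int[m]_z (h (mdist x z / t) * h (mdist y z / t) * approx_psi z t).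

(* Extended-real valued: the integral may diverge when x = y. *)
Definition bessel_kernel (alpha : R) x y : \bar R :=
  (alpha%:E * \int[lebesgue_measure]_(t in `]0%R, +oo[)
     (t `^ alpha / (1 + t `^ alpha) ^+ 2 * approx_kernel x y t / t)%:E)%E.

Definition bessel_defined (alpha : R) g x : Prop :=
  m.-integrable [set: X] (fun z => ((g z)%:E * bessel_kernel alpha x z)%E).

(* Only meaningful at the points x where [bessel_defined alpha g x]. *)
Definition bessel_potential (alpha : R) g x : R :=
  fine (\int[m]_z ((g z)%:E * bessel_kernel alpha x z))%E.

End bessel.

Definition hajlasz_gradient m (beta : R) f g : Prop :=
  [/\ measurable_fun [set: X] g, forall x, 0 <= g x &
      ae_pair m (fun x y => `|f x - f y| <= mdist x y `^ beta * (g x + g y))].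

Definition hajlasz_space m (beta : R) (p : \bar R) : set (X -> R) :=
  [set f | f \in Lfun m p /\
    exists2 g, hajlasz_gradient m beta f g & g \in Lfun m p].

Definition hajlasz_norm m (beta : R) (p : \bar R) f : \bar R :=
  ('N[m]_p[EFin \o f] +
   ereal_inf [set 'N[m]_p[EFin \o g] | g in hajlasz_gradient m beta f])%E.

(* [J] induces a continuous linear operator from (U, nU) to (V, nV), where U
   and V are spaces of functions identified when they are equal a.e. *)
Definition continuous_linear_operator m
    (U : set (X -> R)) (nU : (X -> R) -> \bar R)
    (V : set (X -> R)) (nV : (X -> R) -> \bar R)
    (J : (X -> R) -> X -> R) : Prop :=
  [/\ forall f, U f -> V (J f),
      forall f1 f2, U f1 -> U f2 ->
        (\forall x \ae m, f1 x = f2 x) -> \forall x \ae m, J f1 x = J f2 x,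
      forall (a : R) f1 f2, U f1 -> U f2 ->
        \forall x \ae m, J (fun y => a * f1 y + f2 y) x = a * J f1 x + J f2 x &
      forall f0, U f0 -> forall e : R, 0 < e -> exists2 del : R, 0 < del &
        forall f, U f -> (nU (fun x => f x - f0 x)%R < del%:E)%E ->
          (nV (fun x => J f x - J f0 x)%R < e%:E)%E].

End metric_measure_space.

(* Main.v *)
Require Import Defs.
From HB Require Import structures.
From mathcomp Require Import all_boot all_order all_algebra finmap.
From mathcomp Require Import all_classical all_reals all_analysis.
From mathcomp Require Import measurable_realfun ess_sup_inf ring lra.

Set Implicit Arguments.
Unset Strict Implicit.
Unset Printing Implicit Defensive.

Import Order.TTheory GRing.Theory Num.Theory.
Import numFieldNormedType.Exports.

Local Open Scope classical_set_scope.
Local Open Scope ring_scope.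

(**
The kernel [s] is nonnegative, bounded by [K / t^N] and supported in
[d(x, z) <= 4 t], Lipschitz in [x] at scale [t], and of total mass 1. Writing
[S_t f(x)] for the integral of [s(x, z, t) f(z)] and [V(t)] for the weight
[alpha t^(alpha - 1) / (1 + t^alpha)^2 <= alpha t^(alpha - 1)],
[J f(x) - J f(y)] is the integral over [t > 0] of [V(t) (S_t f(x) - S_t f(y))].
With [D = d(x, y)], the Hajlasz inequality bounds [|S_t f(x) - S_t f(y)|] by
- [C D^beta (M g(x) + M g(y))] for [t <= D], both averages having mass 1;
- [C (D / t) t^beta M g] for [t >= D], since [s(x, ., t) - s(y, ., t)] has mean
  zero and is of size [D / t] times an average at scale [t].
Integrating against [V] gives [D^(alpha + beta)], the far part being integrable
because [alpha + beta < 1].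

As [V] is integrable, [|J f| <= C M f], and [C M g] is a Hajlasz gradient of
[J f], so the boundedness on [L^p] reduces to the maximal theorem, obtained from
the Vitali covering lemma and the layer-cake formula.
*)

(** * Vitali coverings and Ahlfors regular spaces *)

(** Both comparisons are made with the reference value [S_t f(y)] instead of [f(y)]: the pointwise
    Hajlasz bound is always integrated against a kernel, so [g] enters through averages alone, and
    these are bounded by its maximal function without Lebesgue differentiation. The averages in the
    maximal function are normalized by [r^N] and not by [m(B(x, r))]. This version is dominated by
    [c M g] and has open superlevel sets, which makes a multiple of it a measurable gradient of
    [J f]. Two integrability questions come before the estimates. [f] is not assumed locally
    integrable: the Hajlasz inequality against one point off the exceptional set yields it on balls
    where [g] is integrable, and such a point exists because [m(X)] is infinite. And [J f]
    integrates against a kernel that may be infinite, so the exchange with the time integral goes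
    through the positive and negative parts of [f]. *)

Lemma vitali_covering (R : realType) (M : metricType R) (A : set M)
    (r : M -> R) (R0 : R) :
  (forall x, A x -> 0 < r x <= R0) ->
  exists D : set M, [/\ D `<=` A, trivIset D (fun x => ball x (r x)) &
    forall x, A x -> exists2 y, D y & ball x (r x) `<=` ball y (5 * r y)].
Proof.
move=> rR0; pose B x := ball x (r x).
(* Besides disjointness, a ball that meets the family must meet a member of at least half its
   radius. Without this, a maximal disjoint family could consist of balls too small to cover after
   dilation by 5. *)
pose P (D : set M) := [/\ D `<=` A, trivIset D B &
  forall x, A x -> (exists2 y, D y & B x `&` B y !=set0) ->
    exists y, [/\ D y, B x `&` B y !=set0 & r x <= 2 * r y]].
have [F FP totF|D [[DA tD DP] maxD]] := @Zorn_bigcup _ P.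
  split.
  - by apply: bigcup_sub => D /FP[].
  - move=> i j [x Fx] xi [y Fy] yj ij; have [xy|yx] := totF _ _ Fx Fy.
    + by have [_ + _] := FP _ Fy; apply => //; exact: xy.
    + by have [_ + _] := FP _ Fx; apply => //; exact: yx.
  - move=> x Ax [y [D FD Dy] xy]; have [_ _ H] := FP _ FD.
    have [|z [Dz xz rxz]] := H x Ax; first by exists y.
    by exists z; split => //; exists D.
(* If some ball missed the maximal [D], take among such balls one, [B z], with radius more than half
   the supremum of their radii. It can be added to [D]: a ball that meets [B z] but not [D] has
   radius at most that supremum, hence at most [2 * r z]. *)
have meetD x : A x -> exists2 y, D y & B x `&` B y !=set0.
  apply: contraPP => nx Ax.
  pose S := [set r z | z in [set z | A z /\
    forall y, D y -> B z `&` B y = set0]].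
  have Sx : S (r x).
    exists x => //; split => // y Dy; apply/eqP/negPn/negP => /set0P xy.
    by apply: nx; exists y.
  have supS : has_sup S.
    split; first by exists (r x).
    by exists R0 => _ [z [Az _] <-]; have /andP[] := rR0 _ Az.
  have supS0 : 0 < sup S.
    have /andP[rx0 _] := rR0 _ Ax.
    exact: (lt_le_trans rx0 (ub_le_sup supS.2 Sx)).
  have [_ [z [Az zD] <-] rz] : exists2 e, S e & sup S - sup S / 2 < e.
    by apply: sup_adherent => //; rewrite divr_gt0.
  have {}rz : sup S < 2 * r z by lra.
  have Bz : B z z by apply: ballxx; have /andP[] := rR0 _ Az.
  have nDz : ~ D z.
    by move=> /zD; rewrite setIid => Bz0; move: Bz; rewrite Bz0.
  have : D `<` D `|` [set z].
    by split=> [y|]; [left|move=> /(_ z) DDz; exact/nDz/DDz/or_intror].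
  move/maxD; apply; split.
  - by move=> y [/DA//|->].
  - move=> i j [Di|->] [Dj|->] //; first exact: tD.
      by rewrite setIC zD// => -[].
    by rewrite zD// => -[].
  - move=> y Ay [w Dw yw]; have [|/forall2NP nD] :=
      pselect (exists2 w, D w & B y `&` B w !=set0).
      by move=> /(DP _ Ay)[v [Dv yv ryv]]; exists v; split => //; left.
    exists z; split; first by right.
      by case: Dw => [Dw|<-//]; have [] := nD w.
    apply: ltW; apply: (le_lt_trans _ rz); apply: ub_le_sup; first exact: supS.2.
    exists y => //; split => // v Dv; apply/eqP/negPn/negP => /set0P yv.
    by have [] := nD v.
exists D; split => // x Ax.
(* The factor 5: the centres are at distance less than [r x + r y <= 3 * r y], and [B x] adds at
   most [r x <= 2 * r y]. *)
have [y [Dy [u [xu yu]] rxy]] := DP x Ax (meetD x Ax).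
exists y => // v xv; move: xu yu xv; rewrite /B !ballEmdist/= => xu yu xv.
have := metric_triangle y u v; have := metric_triangle u x v.
rewrite (metric_sym u x); lra.
Qed.

Lemma bigcup_countable_measurable d (T : measurableType d) (I : Type)
    (D : set I) (F : I -> set T) : countable D ->
  (forall i, D i -> measurable (F i)) -> measurable (\bigcup_(i in D) F i).
Proof.
elim/Pchoice: I => I in D F *.
have [->|/set0P[i0 Di0]] := eqVneq D set0; first by rewrite bigcup_set0.
move=> /countable_injP[f injf] mF.
have -> : \bigcup_(i in D) F i =
    \bigcup_(n in f @` D) F ('pinv_(cst i0) D f n).
  rewrite bigcup_image; apply: eq_bigcupr => i Di.
  by rewrite pinvKV// inE.
by apply: bigcup_measurable => _ [i Di <-]; rewrite pinvKV ?inE//; exact: mF.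
Qed.

Section ahlfors.
Context {R : realType} {d : measure_display} {X : borelMetricType d R}.

Lemma borel_open_measurable (U : set X) : open U -> measurable U.
Proof. by move=> oU; rewrite borel_measurableE; exact: sub_sigma_algebra. Qed.

Lemma metric_ball_open (x : X) (r : R) : open (ball x r).
Proof.
rewrite openE => y; rewrite ballEmdist/= => xy.
apply/nbhs_ballP; exists (r - mdist x y); first by rewrite /= subr_gt0.
move=> z; rewrite !ballEmdist/= => yz.
by rewrite (le_lt_trans (metric_triangle x y z))// -ltrBrDl.
Qed.

Lemma measurable_metric_ball (x : X) (r : R) : measurable (ball x r).
Proof. exact/borel_open_measurable/metric_ball_open. Qed.

(** Any [n] of these sets have total measure at least [e * n] inside [E], so infinitely many would
    exceed [m E]. This packing argument gives countability twice: for nets of the space and for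
    Vitali families. *)
Lemma trivIset_lb_measure_finite (m : {measure set X -> \bar R})
    (I : choiceType) (D : set I) (F : I -> set X) (E : set X) (e : R) :
  measurable E -> (m E < +oo)%E -> 0 < e ->
  trivIset D F -> (forall i, D i -> measurable (F i)) ->
  (forall i, D i -> F i `<=` E) -> (forall i, D i -> (e%:E <= m (F i))%E) ->
  finite_set D.
Proof.
move=> mE Efin e0 tD mF FE eF; apply: contrapT => /infinite_set_fset Dinf.
have [n En] : exists n : nat, fine (m E) < e * n%:R.
  exists (Num.truncn (fine (m E) / e)).+1.
  by rewrite mulrC -ltr_pdivrMr// truncnS_gt.
have [A AD nA] := Dinf n.
have : (m (\big[setU/set0]_(i <- A) F i) <= m E)%E.
  apply: le_measure; rewrite ?inE//.
    by rewrite -bigcup_fset; apply: fin_bigcup_measurable => // i /AD /mF.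
  by rewrite -bigcup_fset; apply: bigcup_sub => i iA; exact/FE/AD.
rewrite measure_fbigsetU//; last 2 first.
- by move=> i iA; exact/mF/AD.
- by apply: sub_trivIset tD.
apply/negP; rewrite -ltNge.
have -> : m E = (fine (m E))%:E by rewrite fineK// ge0_fin_numE.
apply: (@lt_le_trans _ _ (e * n%:R)%:E); first by rewrite lte_fin.
apply: (@le_trans _ _ (\sum_(i <- A) e%:E)%E); last first.
  by rewrite big_seq [leRHS]big_seq; apply: lee_sum => i /AD /eF.
rewrite sumEFin big_const_seq count_predT iter_addr_0 lee_fin -[leRHS]mulr_natr.
by rewrite ler_pM2l// ler_nat.
Qed.

Section dense.
Variables (m : {measure set X -> \bar R}) (N : R).
Hypothesis m_regular : ahlfors_regular m N.

Lemma ahlfors_ball_lty (x : X) (r : R) : (m (ball x r) < +oo)%E.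
Proof.
have [c c0 /(_ x) reg] := m_regular.
have [r0|r0] := ltP 0 r; first by rewrite (le_lt_trans (reg _ r0).2)// ltry.
have -> : ball x r = set0.
  by apply/seteqP; split => // y; rewrite ballEmdist/= ltNge (le_trans r0)// mdist_ge0.
by rewrite measure0 ltry.
Qed.

Lemma ahlfors_bigcup_ball (x : X) : \bigcup_n ball x n%:R = [set: X].
Proof.
rewrite -subTset => y _; exists (Num.truncn (mdist x y)).+1 => //.
by rewrite ballEmdist/= truncnS_gt.
Qed.

(** This is what gives access to the Tonelli exchanges for [m]. *)
Lemma ahlfors_sigma_finite : sigma_finite [set: X] m.
Proof.
have [[x _]|X0] := pselect ([set: X] !=set0).
  exists (fun n => ball x n%:R); first by rewrite ahlfors_bigcup_ball.
  by move=> n; split; [exact: measurable_metric_ball|exact: ahlfors_ball_lty].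
exists (fun=> set0); last by move=> n; rewrite measure0 ltry.
by apply/seteqP; split => // x _; case: X0; exists x.
Qed.

(** At scale [r k], a maximal family of disjoint balls has finitely many centres in each bounded
    region, by packing, and by maximality its centres form a net of mesh [2 * r k]. The union of
    these nets over [k] is dense. *)
Lemma ahlfors_separable : exists2 D : set X, countable D &
  forall (x : X) (e : R), 0 < e -> exists2 y, D y & mdist x y < e.
Proof.
have [[x0 _]|X0] := pselect ([set: X] !=set0); last first.
  by exists set0 => // x; case: X0; exists x.
have [c c0 reg] := m_regular.
pose r (k : nat) : R := k.+1%:R^-1.
have r0 k : 0 < r k by rewrite invr_gt0.
have net k : exists2 D : set X, countable D &
    forall x, exists2 y, D y & mdist x y < r k + r k.
  have [D [_ tD maxD]] :=
    ex_maximal_disjoint_subcollection (fun x : X => ball x (r k)) setT.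
  exists D.
    have -> : D = \bigcup_n (D `&` ball x0 n%:R).
      by rewrite -setI_bigcupr ahlfors_bigcup_ball setIT.
    apply: bigcup_countable => // n _; apply: finite_set_countable.
    apply: (@trivIset_lb_measure_finite m _ _ (fun x => ball x (r k))
      (ball x0 (n%:R + r k)) (c^-1 * r k `^ N)).
    - exact: measurable_metric_ball.
    - exact: ahlfors_ball_lty.
    - by rewrite mulr_gt0// ?invr_gt0// powR_gt0.
    - by apply: sub_trivIset tD => x [].
    - by move=> *; exact: measurable_metric_ball.
    - by move=> x [_ xn] y xy; exact: ball_triangle xn xy.
    - by move=> x _; have [] := reg x _ (r0 k).
  move=> x; apply: contrapT => nx.
  have nDx y : D y -> ball x (r k) `&` ball y (r k) = set0.
    move=> Dy; apply/eqP/negPn/negP => /set0P[z [xz yz]].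
    by apply: nx; exists y => //; have := ball_triangle xz (ball_sym yz);
      rewrite ballEmdist.
  have nDxx : ~ D x.
    by move=> /nDx; rewrite setIid; apply/eqP/set0P; exists x; exact: ballxx.
  apply: (maxD (D `|` [set x])) => //.
    by split=> [y|]; [left|move=> /(_ x) DDx; exact/nDxx/DDx/or_intror].
  move=> i j [Di|->] [Dj|->] //; first exact: tD.
    by rewrite setIC nDx// => -[].
  by rewrite nDx// => -[].
have /choice[D HD] : forall k, exists D : set X, countable D /\
    forall x, exists2 y, D y & mdist x y < r k + r k.
  by move=> k; have [D ? ?] := net k; exists D.
exists (\bigcup_k D k); first by apply: bigcup_countable => // k _; exact: (HD k).1.
move=> x e e0; pose k := Num.truncn (2 / e).
have [y Dy xy] := (HD k).2 x.
exists y; first by exists k.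
apply: (lt_trans xy); rewrite -mulr2n -mulr_natr mulrC ltr_pdivrMr//.
by rewrite -ltr_pdivrMl// mulrC truncnS_gt.
Qed.

(** Continuity is not enough: an open set of [X * X] lies in the product sigma-algebra only thanks
    to separability. The sublevel sets are written as countable unions of rectangles
    [ball a q * ball a (r - q)], with [a] in the dense set and [q] rational. *)
Lemma measurable_mdist : measurable_fun [set: X * X] (fun p => mdist p.1 p.2).
Proof.
have [D cD Dd] := ahlfors_separable.
move=> _; apply: (measurability _ (RGenInftyO.measurableE R)) => //.
move=> _ [_ [r ->] <-]; rewrite setTI.
have -> : (fun p : X * X => mdist p.1 p.2) @^-1` `]-oo, r[%classic =
    \bigcup_(a in D) \bigcup_(q : rat)
      (ball a (ratr q : R) `*` ball a (r - ratr q)).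
  apply/seteqP; split => [[x y]|[x y] [a Da [q _]]] /=; last first.
    rewrite !ballEmdist !in_itv/= => -[ax ay].
    have := metric_triangle x a y; rewrite (metric_sym x a); lra.
  (* With [e] half the gap, [d(x, a) < q < e] yields [d(a, y) < e + (r - 2 * e) = r - e < r - q]. *)
  rewrite in_itv/= => xyr; pose e := (r - mdist x y) / 2.
  have e0 : 0 < e by rewrite divr_gt0 ?subr_gt0.
  have [a Da xa] := Dd x e e0.
  have [|q] := @rat_in_itvoo R (mdist x a) e; first by [].
  rewrite in_itv/= => /andP[aq qe].
  exists a => //; exists q => //; rewrite !ballEmdist/= (metric_sym a x); split => //.
  have := metric_triangle a x y; rewrite (metric_sym a x) /e in qe *.
  by move: qe xa; rewrite /e; lra.
apply: bigcup_countable_measurable => // a _; apply: bigcupT_measurable_rat => q.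
by apply: measurableX; exact: measurable_metric_ball.
Qed.

End dense.

End ahlfors.

(** * The kernel of the approximation of the identity *)

(** The consequences of smoothness on which the kernel estimates rest. They bear on the whole line
    because they are meant for [u |-> h |u|], the values of the original cutoff at negative
    arguments being arbitrary. *)
Definition lipschitz_cutoff (R : realType) (L : R) (h : R -> R) : Prop :=
  [/\ forall u, 0 <= h u <= 1, forall u v, `|h u - h v| <= L * `|u - v|,
      forall u, `|u| <= 2^-1 -> h u = 1 & forall u, 2 <= `|u| -> h u = 0].

(** The derivative of [h] is continuous on [[1/2, 2]], hence bounded there, and the mean value
    theorem applies; elsewhere on the half-line [h] is constant. The absolute value is 1-Lipschitz
    and leaves the constant unchanged. *)
Lemma smooth_cutoff_lipschitz (R : realType) (h : R -> R) : smooth_cutoff h ->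
  exists2 L, 0 < L & lipschitz_cutoff L (fun u => h `|u|).
Proof.
case=> h0 hdecr hder h1 h2.
have dh u : 0 < u -> derivable h u 1 by exact: (hder 0%N).
have ch u : 0 < u -> {for u, continuous h}.
  by move=> /dh hu; exact/differentiable_continuous/derivable1_diffP.
have cdh u : 0 < u -> {for u, continuous (derive1 h)}.
  by move=> /(hder 1%N) hu; exact/differentiable_continuous/derivable1_diffP.
have [c _ cmax] : exists2 c : R, c \in `[2^-1, 2] & forall t : R, t \in `[2^-1, 2] ->
    `|(derive1 h) t| <= `|(derive1 h) c|.
  apply: (@EVT_max _ (fun t => `|(derive1 h) t|)); first by lra.
  apply: continuous_in_subspaceT => u; rewrite inE/= in_itv/= => /andP[u2 _].
  have : {for u, continuous (Num.norm \o derive1 h)}.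
    apply: continuous_comp; first by apply: cdh; lra.
    exact: norm_continuous.
  by [].
pose L := `|(derive1 h) c| + 1.
have L0 : 0 < L by rewrite ltr_wpDl.
have lip_mid u v : 2^-1 <= u -> u <= v -> v <= 2 -> `|h u - h v| <= L * `|u - v|.
  move=> u2 uv v2.
  have [|||w wuv hvu] := @MVT_segment _ h (derive1 h) u v; first by [].
  - move=> w; rewrite in_itv/= => /andP[uw _]; rewrite derive1E.
    by apply: derivableP; apply: dh; lra.
  - apply: continuous_in_subspaceT => w; rewrite inE/= in_itv/= => /andP[uw _].
    by apply: ch; lra.
  - rewrite distrC hvu normrM [ `|u - v| ]distrC ler_wpM2r//.
    apply: (@le_trans _ _ `|(derive1 h) c|); last by rewrite /L lerDl.
    by apply: cmax; move: wuv; rewrite !in_itv/=; lra.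
(* On the half-line [h] factors through the projection onto [[1/2, 2]], which is nondecreasing and
   1-Lipschitz. This replaces a case analysis on the positions of [u] and [v] and never
   differentiates at 0. *)
pose clamp (u : R) := Num.max 2^-1 (Num.min 2 u).
have hclamp u : 0 <= u -> h u = h (clamp u).
  move=> u0; rewrite /clamp; case: (leP 2 u) => [u2|u2].
    rewrite (max_idPr _); last by lra.
    by rewrite !h2.
  by case: (leP 2^-1 u) => // u2'; rewrite !h1//; lra.
have clamp_itv u : 2^-1 <= clamp u <= 2.
  by rewrite /clamp le_max lexx/= ge_max ge_min lexx/= andbT; lra.
have clamp_le u v : u <= v -> clamp u <= clamp v.
  by move=> uv; rewrite /clamp; case: (leP 2 u) => ?; case: (leP 2 v) => ?;
    rewrite !maxEle; repeat case: ifPn; lra.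
have clamp_lip u v : u <= v -> clamp v - clamp u <= v - u.
  by move=> uv; rewrite /clamp; case: (leP 2 u) => ?; case: (leP 2 v) => ?;
    rewrite !maxEle; repeat case: ifPn; lra.
have lip u v : 0 <= u -> u <= v -> `|h u - h v| <= L * `|u - v|.
  move=> u0 uv; rewrite (hclamp u)// (hclamp v)//; last exact: le_trans uv.
  have /andP[u1 u2] := clamp_itv u; have /andP[v1 v2] := clamp_itv v.
  apply: (le_trans (lip_mid _ _ u1 (clamp_le _ _ uv) v2)).
  rewrite ler_wpM2l// ?(ltW L0)// distrC ger0_norm ?subr_ge0 ?clamp_le//.
  by rewrite distrC ger0_norm ?subr_ge0// clamp_lip.
exists L => //; split => /=.
- move=> u; rewrite h0//= -(h1 0); last by lra.
  exact: hdecr.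
- move=> u v; apply: (@le_trans _ _ (L * `| `|u| - `|v| |)); last first.
    by rewrite ler_wpM2l ?(ltW L0)// ler_dist_dist.
  have [uv|/ltW vu] := leP `|u| `|v|; first exact: lip.
  by rewrite distrC [ `| `|u| - _| ]distrC; exact: lip.
- by move=> u u2; apply: h1; rewrite normr_ge0.
- by move=> u u2; exact: h2.
Qed.

Lemma lipschitz_cutoff_measurable (R : realType) (L : R) (h : R -> R) :
  lipschitz_cutoff L h -> measurable_fun [set: R] h.
Proof.
move=> [_ lip _ _]; apply: continuous_measurable_fun => u.
have L0 : 0 <= L.
  by have := le_trans (normr_ge0 _) (lip 1 0); rewrite subr0 normr1 mulr1.
have L1 : 0 < L + 1 by rewrite ltr_wpDl.
apply/cvgrPdist_le => e e0; apply/nbhs_ballP.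
exists (e / (L + 1)); first by rewrite /= divr_gt0.
move=> v; rewrite /ball/= ltr_pdivlMr// => /ltW uv.
apply: (le_trans (lip _ _)); apply: le_trans uv.
by rewrite mulrC ler_wpM2l// lerDl.
Qed.

Section measurable_lemmas.
Context {d : measure_display} {T : measurableType d} {R : realType}.

(** The inverse is [f * (f^2)^(-1)], a product with a measurable power. At the zeros of [f] both
    expressions are 0, since [0^-1 = 0]. *)
Lemma measurable_fun_inv (f : T -> R) :
  measurable_fun [set: T] f -> measurable_fun [set: T] (fun x => (f x)^-1).
Proof.
move=> mf; rewrite (_ : (fun x => _) = (fun x => f x * (f x ^+ 2) `^ (-1))).
  apply: measurable_funM => //; apply: (measurableT_comp (measurable_powR _)).
  exact: measurable_funX.
apply/funext => x; rewrite powR_inv1 ?sqr_ge0//.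
by have [->|fx0] := eqVneq (f x) 0; [rewrite invr0 mul0r|field].
Qed.

(** Tonelli gives measurability of the extended integral even where it diverges; [fine] sends those
    points to 0 and is itself measurable. *)
Lemma measurable_Rintegral_param {d' : measure_display}
    {U : measurableType d'} (m : {sigma_finite_measure set U -> \bar R})
    (f : T -> U -> R) : (forall x u, 0 <= f x u) ->
  measurable_fun [set: T * U] (fun p => f p.1 p.2) ->
  measurable_fun [set: T] (fun x => \int[m]_u f x u).
Proof.
move=> f0 mf; apply: (@measurableT_comp _ _ _ _ _ _ fine).
  exact: fine_measurable.
apply: (@measurable_fun_fubini_tonelli_F _ _ _ _ _ m (fun p => (f p.1 p.2)%:E)).
  exact/measurable_EFinP.
by move=> p; rewrite lee_fin.
Qed.

End measurable_lemmas.

Section kernel.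
Context {R : realType} {d : measure_display} {X : borelMetricType d R}.
Variables (m : {sigma_finite_measure set X -> \bar R}) (N c L : R) (h : R -> R).
Hypothesis c_gt0 : 0 < c.
Hypothesis m_ball : forall (x : X) (r : R), 0 < r ->
  ((c^-1 * r `^ N)%:E <= m (ball x r))%E /\ (m (ball x r) <= (c * r `^ N)%:E)%E.
Hypothesis h_cutoff : lipschitz_cutoff L h.

Let h_ge0 u : 0 <= h u. Proof. by have [/(_ u)/andP[]] := h_cutoff. Qed.
Let h_le1 u : h u <= 1. Proof. by have [/(_ u)/andP[]] := h_cutoff. Qed.
Let L_ge0 : 0 <= L.
Proof.
have [_ lip _ _] := h_cutoff.
by have := le_trans (normr_ge0 _) (lip 1 0); rewrite subr0 normr1 mulr1.
Qed.
Let mh : measurable_fun [set: R] h.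
Proof. exact: lipschitz_cutoff_measurable h_cutoff. Qed.
Let m_dist : measurable_fun [set: X * X] (fun p => mdist p.1 p.2).
Proof. by apply: (@measurable_mdist _ _ _ m N); exists c. Qed.

Lemma integral_ball_bounded (x : X) (r B : R) (G : X -> R) : 0 < r ->
  measurable_fun [set: X] G ->
  (forall y, `|G y| <= B * \1_(ball x r) y) ->
  m.-integrable [set: X] (EFin \o G) /\
  (\int[m]_y `|(G y)%:E| <= (B * (c * r `^ N))%:E)%E.
Proof.
move=> r0 mG GB.
have B0 : 0 <= B.
  by have := le_trans (normr_ge0 _) (GB x); rewrite indicE mem_set ?mulr1//; exact: ballxx.
have le_int : (\int[m]_y `|(G y)%:E| <= (B * (c * r `^ N))%:E)%E.
  apply: (@le_trans _ _ (\int[m]_y (B * \1_(ball x r) y)%:E)%E).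
    apply: ge0_le_integral => //.
    - by apply: measurableT_comp => //; exact/measurable_EFinP.
    - apply/measurable_EFinP; apply: measurable_funM => //.
      exact/measurable_indic/measurable_metric_ball.
    - by move=> y _; rewrite abse_EFin lee_fin.
  under eq_integral do rewrite EFinM.
  rewrite ge0_integralZl_EFin//; last first.
    by apply/measurable_EFinP/measurable_indic/measurable_metric_ball.
  rewrite integral_indic// ?setIT; last exact: measurable_metric_ball.
  by rewrite EFinM lee_wpmul2l ?lee_fin// (m_ball _ r0).2.
split => //; apply/integrableP; split; first exact/measurable_EFinP.
by rewrite (le_lt_trans le_int)// ltry.
Qed.

Section fixed_time.
Variable t : R.
Hypothesis t_gt0 : 0 < t.

Let t_ge0 : 0 <= t. Proof. exact: ltW. Qed.

Let dt_ge0 (x y : X) : 0 <= mdist x y / t.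
Proof. by rewrite divr_ge0 ?mdist_ge0. Qed.

Let powR2t : (2 * t) `^ N = 2 `^ N * t `^ N.
Proof. by rewrite powRM. Qed.

Let powRt2 : (t / 2) `^ N = (2 `^ N)^-1 * t `^ N.
Proof. by rewrite powRM ?invr_ge0// mulrC -powR_inv1// -powRrM mulN1r powRN. Qed.

Let cut (x y : X) := h (mdist x y / t).

Let cut0 x y : 2 * t <= mdist x y -> cut x y = 0.
Proof.
move=> xy; have [_ _ _] := h_cutoff; apply.
by rewrite ger0_norm// ler_pdivlMr.
Qed.

Let cut1 x y : ball x (t / 2) y -> cut x y = 1.
Proof.
rewrite ballEmdist/= => xy; have [_ _ + _] := h_cutoff; apply.
by rewrite ger0_norm// ler_pdivrMr// mulrC ltW.
Qed.

Let cut_ge0 x y : 0 <= cut x y. Proof. exact: h_ge0. Qed.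

Let cut_le1 x y : cut x y <= 1. Proof. exact: h_le1. Qed.

Let cut_le x y : cut x y <= \1_(ball x (2 * t)) y.
Proof.
rewrite indicE; have [_|] := boolP (y \in _); first exact: h_le1.
by rewrite notin_setE ballEmdist/= => /negP; rewrite -leNgt => /cut0 ->.
Qed.

(** The indicators are what makes the Lipschitz bound integrable in [u]: off both balls the two
    cutoffs vanish. *)
Let cut_lip x y u :
  `|cut x u - cut y u| <= L * (mdist x y / t) *
     (\1_(ball x (2 * t)) u + \1_(ball y (2 * t)) u).
Proof.
have main : `|cut x u - cut y u| <= L * (mdist x y / t).
  have [_ lip _ _] := h_cutoff; apply: (le_trans (lip _ _)).
  rewrite ler_wpM2l// -mulrBl normrM [ `|t^-1|]gtr0_norm ?invr_gt0//.
  rewrite ler_wpM2r ?invr_ge0// ler_norml.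
  have := metric_triangle x y u; have := metric_triangle y x u.
  by rewrite (metric_sym y x); lra.
have [xu|xu] := leP 1 (\1_(ball x (2 * t)) u + \1_(ball y (2 * t)) u : R).
  apply: (le_trans main); rewrite ler_peMr//.
  by rewrite mulr_ge0.
have x0 : cut x u = 0.
  apply/eqP; rewrite eq_le h_ge0 andbT; apply: (le_trans (cut_le _ _)).
  by move: xu; rewrite !indicE; do 2 case: (_ \in _) => //=; lra.
have y0 : cut y u = 0.
  apply/eqP; rewrite eq_le h_ge0 andbT; apply: (le_trans (cut_le _ _)).
  by move: xu; rewrite !indicE; do 2 case: (_ \in _) => //=; lra.
by rewrite x0 y0 subrr normr0 mulr_ge0// mulr_ge0.
Qed.

Let mcut x : measurable_fun [set: X] (cut x).
Proof.
apply: measurableT_comp => //; apply: measurable_funM => //.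
by apply: (measurableT_comp m_dist (g := pair x)).
Qed.

(** * Averages against the cutoff at a fixed time *)

Section average.
Variables (F : X -> R) (B : R).
Hypothesis F_meas : measurable_fun [set: X] F.
Hypothesis F_bound : forall y, `|F y| <= B.

Let B_ge0 (x : X) : 0 <= B. Proof. exact: le_trans (F_bound x). Qed.

Let mcF x : measurable_fun [set: X] (fun y => cut x y * F y).
Proof. exact: measurable_funM. Qed.

Let cF_le x y : `|cut x y * F y| <= B * \1_(ball x (2 * t)) y.
Proof.
by rewrite normrM mulrC ler_pM// ger0_norm ?h_ge0.
Qed.

Lemma average_integrable x :
  m.-integrable [set: X] (fun y => (h (mdist x y / t) * F y)%:E).
Proof.
by apply: (integral_ball_bounded _ (mcF x) (cF_le x)).1; rewrite mulr_gt0.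
Qed.

Lemma average_bound x :
  `|\int[m]_y (h (mdist x y / t) * F y)| <= B * (c * 2 `^ N * t `^ N).
Proof.
rewrite -lee_fin EFin_normr_Rintegral//; last exact: average_integrable.
apply: (le_trans (le_abse_integral _ _ _)) => //; first exact/measurable_EFinP/mcF.
rewrite -mulrA -powR2t.
by apply: (integral_ball_bounded _ (mcF x) (cF_le x)).2; rewrite mulr_gt0.
Qed.

Lemma average_lower_bound x b : 0 <= b -> (forall y, b <= F y) ->
  b * ((c * 2 `^ N)^-1 * t `^ N) <= \int[m]_y (h (mdist x y / t) * F y).
Proof.
move=> b0 bF; rewrite -lee_fin fineK; last first.
  by apply: integrable_fin_num => //; exact: average_integrable.
apply: (@le_trans _ _ (\int[m]_y (b * \1_(ball x (t / 2)) y)%:E)%E).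
  under eq_integral do rewrite EFinM.
  rewrite ge0_integralZl_EFin//; last first.
    by apply/measurable_EFinP/measurable_indic/measurable_metric_ball.
  rewrite integral_indic// ?setIT; last exact: measurable_metric_ball.
  rewrite EFinM lee_wpmul2l ?lee_fin// invfM -mulrA -powRt2.
  by apply: (m_ball _ _).1; rewrite divr_gt0.
apply: ge0_le_integral => //.
- by move=> y _; rewrite lee_fin mulr_ge0.
- apply/measurable_EFinP; apply: measurable_funM => //.
  exact/measurable_indic/measurable_metric_ball.
- exact/measurable_EFinP/mcF.
- move=> y _; rewrite lee_fin indicE.
  have [|_] := boolP (y \in _); last by rewrite mulr0 mulr_ge0// (le_trans b0).
  by rewrite inE => /cut1; rewrite /cut => ->; rewrite mulr1 mul1r.
Qed.

(** The difference of the cutoffs lives on two balls of radius [2 * t], each of measure at most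
    [c * 2^N * t^N]; hence the last factor 2. *)
Lemma average_lipschitz x y :
  `|\int[m]_u (h (mdist x u / t) * F u) - \int[m]_u (h (mdist y u / t) * F u)|
    <= B * (L * (mdist x y / t)) * (2 * (c * 2 `^ N * t `^ N)).
Proof.
have t2 : 0 < 2 * t by rewrite mulr_gt0.
have [ix iy] := (average_integrable x, average_integrable y).
rewrite -RintegralB//=.
under eq_Rintegral do rewrite -mulrBl.
pose B' := B * (L * (mdist x y / t)).
have B'0 : 0 <= B' by rewrite mulr_ge0 ?(B_ge0 x)// mulr_ge0.
pose G (z u : X) : R := B' * \1_(ball z (2 * t)) u.
have G0 z u : 0 <= G z u by rewrite mulr_ge0.
have mG z : measurable_fun [set: X] (G z).
  by apply: measurable_funM => //; exact/measurable_indic/measurable_metric_ball.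
have leG z : (\int[m]_u `|(G z u)%:E| <= (B' * (c * (2 * t) `^ N))%:E)%E.
  by apply: (integral_ball_bounded (x := z) t2 (mG z) _).2 => u; rewrite ger0_norm.
have mD : measurable_fun [set: X] (fun u => (cut x u - cut y u) * F u).
  by apply: measurable_funM => //; apply: measurable_funB.
rewrite -lee_fin EFin_normr_Rintegral//; last first.
  have := integrableB measurableT ix iy; apply: eq_integrable => // u _.
  by rewrite /= -EFinB -mulrBl.
apply: (le_trans (le_abse_integral _ _ _)) => //; first exact/measurable_EFinP.
apply: (@le_trans _ _ (\int[m]_u (`|(G x u)%:E| + `|(G y u)%:E|))%E).
  apply: ge0_le_integral => //.
  - by apply: measurableT_comp => //; exact/measurable_EFinP.
  - by apply: emeasurable_funD; apply: measurableT_comp => //; exact/measurable_EFinP.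
  - move=> u _; rewrite !abse_EFin -EFinD lee_fin.
    rewrite (ger0_norm (G0 x u)) (ger0_norm (G0 y u)) normrM /G -mulrDr.
    by rewrite mulrC /B' -mulrA ler_pM// cut_lip.
rewrite ge0_integralD//; last 2 first.
- by apply: measurableT_comp => //; exact/measurable_EFinP.
- by apply: measurableT_comp => //; exact/measurable_EFinP.
apply: (le_trans (leeD (leG x) (leG y))).
rewrite -EFinD lee_fin powR2t /B' le_eqVlt; apply/orP; left; apply/eqP; ring.
Qed.

End average.

(** Regularity bounds the measure of a ball of radius [2 * t] by [A * t^N] and that of a ball of
    radius [t / 2] from below by [t^N / A]. The cutoff lies between the two indicators, so [A]
    controls [T_t] from both sides, and the kernel constants are built from powers of [A] and from
    [L]. *)
Let A := c * 2 `^ N.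
Let A_gt0 : 0 < A. Proof. by rewrite mulr_gt0// powR_gt0. Qed.
Let tN_gt0 : 0 < t `^ N. Proof. exact: powR_gt0. Qed.
Let tN_neq0 : t `^ N != 0. Proof. exact: lt0r_neq0. Qed.

Let T1 (x : X) := approx_id m N h t (fun=> 1) x.
Let phi (x : X) := approx_phi m N h x t.
Let Tphi (x : X) := approx_id m N h t phi x.
Let psi (x : X) := approx_psi m N h x t.

Lemma approx_id_bounds (F : X -> R) (b B : R) (x : X) : 0 <= b ->
  measurable_fun [set: X] F -> (forall y, b <= F y <= B) ->
  b / A <= approx_id m N h t F x <= B * A.
Proof.
move=> b0 mF bFB.
have FB y : `|F y| <= B.
  by have /andP[bF FB] := bFB y; rewrite ger0_norm// (le_trans b0).
rewrite /approx_id powRN; apply/andP; split.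
  rewrite [leRHS]mulrC ler_pdivlMr//.
  have := @average_lower_bound F B mF FB x b b0 (fun y => proj1 (andP (bFB y))).
  by rewrite mulrA.
rewrite [leLHS]mulrC ler_pdivrMr// -mulrA.
exact: le_trans (ler_norm _) (average_bound mF FB x).
Qed.

Let inv_bounds (a b x : R) : 0 < a -> 0 < b -> a <= x <= b -> b^-1 <= x^-1 <= a^-1.
Proof.
move=> a0 b0 /andP[ax xb]; have x0 := lt_le_trans a0 ax.
by rewrite !lef_pV2 ?posrE// ax xb.
Qed.

Let T1_bounds x : A^-1 <= T1 x <= A.
Proof.
have := @approx_id_bounds (fun=> 1) 1 1 x ler01 (measurable_cst _) (fun=> ltac:(by rewrite lexx)).
by rewrite !mul1r.
Qed.

Lemma approx_phi_bounds x : A^-1 <= phi x <= A.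
Proof.
by rewrite -[X in _ <= _ <= X]invrK; apply: inv_bounds (T1_bounds x); rewrite ?invr_gt0.
Qed.

Let mT1 : measurable_fun [set: X] T1.
Proof.
apply: measurable_funM => //; apply: measurable_Rintegral_param.
  by move=> x u; rewrite mulr1.
apply: measurable_funM => //; apply: measurableT_comp => //.
exact: measurable_funM.
Qed.

Let mphi : measurable_fun [set: X] phi.
Proof.
exact: measurable_fun_inv.
Qed.

Let Tphi_bounds x : (A ^+ 2)^-1 <= Tphi x <= A ^+ 2.
Proof.
rewrite expr2 invfM; apply: approx_id_bounds => // [|y].
  by rewrite invr_ge0 ltW.
exact: approx_phi_bounds.
Qed.

Let mTphi : measurable_fun [set: X] Tphi.
Proof.
apply: measurable_funM => //; apply: measurable_Rintegral_param.
  move=> x u; rewrite mulr_ge0//; have /andP[+ _] := approx_phi_bounds u.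
  by apply: le_trans; rewrite invr_ge0 ltW.
apply: measurable_funM; last exact: measurableT_comp.
by apply: measurableT_comp => //; exact: measurable_funM.
Qed.

Lemma approx_psi_bounds x : (A ^+ 2)^-1 <= psi x <= A ^+ 2.
Proof.
rewrite -[X in _ <= _ <= X]invrK; apply: inv_bounds (Tphi_bounds x);
  by rewrite ?invr_gt0// exprn_gt0.
Qed.

Let mpsi : measurable_fun [set: X] psi.
Proof.
exact: measurable_fun_inv.
Qed.

Let phi_ge0 x : 0 <= phi x.
Proof. by have /andP[+ _] := approx_phi_bounds x; apply: le_trans; rewrite invr_ge0 ltW. Qed.

Let psi_ge0 x : 0 <= psi x.
Proof.
have /andP[+ _] := approx_psi_bounds x.
by apply: le_trans; rewrite invr_ge0 exprn_ge0// ltW.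
Qed.

Let t2N : t `^ (2 * N) = t `^ N ^+ 2.
Proof. by rewrite mulrC powRrM powR_mulrn// powR_ge0. Qed.

Let I (x z : X) := \int[m]_u (cut x u * cut z u * psi u).

Let kernelE x z : approx_kernel m N h x z t = phi x * phi z / t `^ N ^+ 2 * I x z.
Proof. by rewrite -t2N. Qed.

Let IE x z : I x z = \int[m]_u (cut x u * (cut z u * psi u)).
Proof. by apply: eq_Rintegral => u _; rewrite mulrA. Qed.

Let cpsi_le z u : `|cut z u * psi u| <= A ^+ 2.
Proof.
rewrite ger0_norm ?mulr_ge0//; have /andP[_] := approx_psi_bounds u.
by apply: le_trans; rewrite ler_piMl.
Qed.

Let mcpsi z : measurable_fun [set: X] (fun u => cut z u * psi u).
Proof. exact: (measurable_funM (mcut z) mpsi). Qed.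

Let I_ge0 x z : 0 <= I x z.
Proof. by apply: Rintegral_ge0 => u _; rewrite !mulr_ge0. Qed.

Let I_le x z : I x z <= A ^+ 3 * t `^ N.
Proof.
rewrite IE; apply: (le_trans (ler_norm _)).
apply: (le_trans (average_bound (mcpsi z) (cpsi_le z) x)).
by rewrite le_eqVlt; apply/orP; left; apply/eqP; rewrite /A; ring.
Qed.

Let I_lip x y z : `|I x z - I y z| <= 2 * A ^+ 3 * L * (mdist x y / t) * t `^ N.
Proof.
rewrite !IE; apply: (le_trans (average_lipschitz (mcpsi z) (cpsi_le z) x y)).
by rewrite le_eqVlt; apply/orP; left; apply/eqP; rewrite /A; ring.
Qed.

Let phi_lip x y : `|phi x - phi y| <= 2 * A ^+ 3 * L * (mdist x y / t).
Proof.
have T1lip : `|T1 x - T1 y| <= 2 * A * L * (mdist x y / t).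
  rewrite -mulrBr normrM powRN gtr0_norm ?invr_gt0// [leLHS]mulrC ler_pdivrMr//.
  have := @average_lipschitz (fun=> 1) 1 (measurable_cst _)
    (fun=> ltac:(by rewrite normr1)) x y.
  by move/le_trans; apply; rewrite le_eqVlt; apply/orP; left; apply/eqP; rewrite /A; ring.
have T10 z : 0 < T1 z.
  by have /andP[+ _] := T1_bounds z; apply: lt_le_trans; rewrite invr_gt0.
have -> : phi x - phi y = phi x * phi y * (T1 y - T1 x).
  by rewrite /phi /approx_phi -/(T1 x) -/(T1 y); field; rewrite !gt_eqF.
rewrite normrM distrC [X in X * _]ger0_norm ?mulr_ge0//.
have /andP[_ Ax] := approx_phi_bounds x; have /andP[_ Ay] := approx_phi_bounds y.
apply: (le_trans (ler_pM _ _ (ler_pM _ _ Ax Ay) T1lip)) => //; first exact: mulr_ge0.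
by rewrite le_eqVlt; apply/orP; left; apply/eqP; ring.
Qed.

Lemma approx_kernel_ge0 x z : 0 <= approx_kernel m N h x z t.
Proof. by rewrite kernelE !mulr_ge0// invr_ge0 exprn_ge0// ltW. Qed.

(** Each [phi] contributes [A] and the integral [A^3 * t^N], against [t^(2N)] below. The support
    comes from the integrand: if both cutoffs are nonzero at [u], then [d(x, z) < 4 * t]. *)
Lemma approx_kernel_bound x z :
  approx_kernel m N h x z t <= A ^+ 5 / t `^ N * \1_(ball x (4 * t)) z.
Proof.
rewrite indicE; have [_|] := boolP (z \in _); last first.
  rewrite notin_setE ballEmdist/= => /negP; rewrite -leNgt => xz.
  rewrite kernelE (_ : I x z = 0) ?mulr0//.
  rewrite /I; under eq_Rintegral => u _.
    rewrite (_ : cut x u * cut z u * _ = 0); first over.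
    have [xu|/cut0->] := ltP (mdist x u) (2 * t); last by rewrite !mul0r.
    rewrite (cut0 (x := z)) ?mulr0 ?mul0r//.
    by have := metric_triangle x u z; rewrite (metric_sym u z); lra.
  by rewrite Rintegral_cst// mul0r.
rewrite mulr1 kernelE.
have /andP[_ Ax] := approx_phi_bounds x; have /andP[_ Az] := approx_phi_bounds z.
have -> : A ^+ 5 / t `^ N = A * A / t `^ N ^+ 2 * (A ^+ 3 * t `^ N) by field.
apply: ler_pM => //; first by rewrite !mulr_ge0// invr_ge0 exprn_ge0// ltW.
by apply: ler_wpM2r; rewrite ?invr_ge0 ?exprn_ge0 ?(ltW tN_gt0)// ler_pM.
Qed.

(** Product rule: the variation of [phi] contributes [2 * A^7 * L] and that of the integral
    [2 * A^5 * L]. The localization in [z] is recovered later, in [smooth_diff_far], from the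
    supports of the two kernels. *)
Lemma approx_kernel_lipschitz x y z :
  `|approx_kernel m N h x z t - approx_kernel m N h y z t| <=
    (2 * A ^+ 7 * L + 2 * A ^+ 5 * L) * (mdist x y / t) / t `^ N.
Proof.
rewrite !kernelE.
have -> : phi x * phi z / t `^ N ^+ 2 * I x z - phi y * phi z / t `^ N ^+ 2 * I y z =
  phi z / t `^ N ^+ 2 * ((phi x - phi y) * I x z + phi y * (I x z - I y z)) by field.
have /andP[_ Ay] := approx_phi_bounds y; have /andP[_ Az] := approx_phi_bounds z.
have t20 : 0 <= (t `^ N ^+ 2)^-1 by rewrite invr_ge0 exprn_ge0// ltW.
have -> : (2 * A ^+ 7 * L + 2 * A ^+ 5 * L) * (mdist x y / t) / t `^ N =
  A / t `^ N ^+ 2 * ((2 * A ^+ 3 * L * (mdist x y / t)) * (A ^+ 3 * t `^ N) +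
    A * (2 * A ^+ 3 * L * (mdist x y / t) * t `^ N)).
  by field; rewrite tN_neq0 gt_eqF.
rewrite normrM ler_pM//.
  by rewrite normrM ger0_norm// [X in _ * X]ger0_norm// ler_wpM2r.
apply: (le_trans (ler_normD _ _)); rewrite !normrM lerD//.
  by rewrite ler_pM// ger0_norm.
by rewrite ler_pM// ger0_norm.
Qed.

Let EFin_average (F : X -> R) (B : R) x : measurable_fun [set: X] F ->
  (forall y, `|F y| <= B) ->
  (\int[m]_u (cut x u * F u)%:E = (\int[m]_u (cut x u * F u))%:E)%E.
Proof.
move=> mF FB; rewrite fineK//; apply: integrable_fin_num => //.
exact: average_integrable mF FB x.
Qed.

Let cutC x y : cut x y = cut y x. Proof. by rewrite /cut metric_sym. Qed.

(* Tonelli reduces the mass to [phi x / t^N * (T_t 1) x], since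
   [psi * T_t phi = 1]. *)
Lemma approx_kernel_mass x :
  (\int[m]_z (approx_kernel m N h x z t)%:E = 1)%E.
Proof.
have t2_ge0 : 0 <= phi x / t `^ N ^+ 2 by rewrite mulr_ge0// invr_ge0 exprn_ge0// ltW.
pose G (p : X * X) := (phi p.1 * (cut x p.2 * cut p.1 p.2 * psi p.2))%:E.
have G0 p : (0 <= G p)%E by rewrite lee_fin !mulr_ge0.
have mcut2 : measurable_fun [set: X * X] (fun p => cut p.1 p.2).
  by apply: measurableT_comp => //; exact: measurable_funM.
have mG : measurable_fun [set: X * X] G.
  apply/measurable_EFinP; apply: measurable_funM; first exact: measurableT_comp.
  apply: measurable_funM; last exact: measurableT_comp.
  by apply: measurable_funM => //; exact: (measurableT_comp (mcut x)).
transitivity ((phi x / t `^ N ^+ 2)%:E * \int[m]_z \int[m]_u G (z, u))%E.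
  rewrite -ge0_integralZl_EFin//; last 2 first.
  - by move=> z _; exact: integral_ge0.
  - exact: (measurable_fun_fubini_tonelli_F G mG G0).
  apply: eq_integral => z _; rewrite kernelE IE.
  transitivity ((phi x / t `^ N ^+ 2)%:E * ((phi z)%:E * (\int[m]_u (cut x u * (cut z u * psi u)))%:E))%E.
    by rewrite -!EFinM; congr EFin; ring.
  rewrite -(EFin_average _ (mcpsi z) (cpsi_le z)) -ge0_integralZl_EFin//.
  - by congr (_ * _)%E; apply: eq_integral => u _; rewrite /G/= -EFinM; congr EFin; ring.
  - by move=> u _; rewrite lee_fin !mulr_ge0.
  - by apply/measurable_EFinP; apply: measurable_funM.
rewrite (fubini_tonelli G)//.
transitivity ((phi x / t `^ N ^+ 2)%:E * \int[m]_u (t `^ N * (cut x u * 1))%:E)%E.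
  congr (_ * _)%E; apply: eq_integral => u _.
  transitivity ((cut x u * psi u)%:E * \int[m]_z (cut u z * phi z)%:E)%E.
    rewrite -(@ge0_integralZl_EFin _ _ _ m _ measurableT
      (fun z => (cut u z * phi z)%:E)).
    - by apply: eq_integral => z _; rewrite /G/= -EFinM (cutC u z); congr EFin; ring.
    - by move=> z _; rewrite lee_fin mulr_ge0.
    - by apply/measurable_EFinP; apply: measurable_funM.
    - by rewrite mulr_ge0.
  rewrite (@EFin_average _ A)//; last first.
    by move=> y; rewrite ger0_norm//; have /andP[] := approx_phi_bounds y.
  rewrite -EFinM; congr EFin.
  have Tphi0 : 0 < Tphi u.
    have /andP[+ _] := Tphi_bounds u; apply: lt_le_trans.
    by rewrite invr_gt0 exprn_gt0.
  have -> : \int[m]_z (cut u z * phi z) = t `^ N * Tphi u.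
    by rewrite /Tphi /approx_id powRN mulVKf.
  rewrite /psi /approx_psi -/phi -/(Tphi u) mulr1.
  by field; rewrite gt_eqF.
under eq_integral do rewrite EFinM.
rewrite ge0_integralZl_EFin//; last 3 first.
- by move=> u _; rewrite lee_fin mulr1.
- by apply/measurable_EFinP; exact: measurable_funM.
- exact: ltW.
rewrite (@EFin_average _ 1)//; last by move=> _; rewrite normr1.
rewrite -!EFinM; congr EFin.
have -> : \int[m]_u (cut x u * 1) = t `^ N * T1 x.
  by rewrite /T1 /approx_id powRN mulVKf.
have T10 : 0 < T1 x.
  by have /andP[+ _] := T1_bounds x; apply: lt_le_trans; rewrite invr_gt0.
by rewrite /phi /approx_phi -/(T1 x); field; rewrite tN_neq0 gt_eqF.
Qed.

End fixed_time.

(* Joint measurability holds at all times since every factor is nonnegative,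
   even at the irrelevant times [t <= 0]. *)
Lemma measurable_approx_kernel : measurable_fun [set: (X * X) * R]
  (fun p => approx_kernel m N h p.1.1 p.1.2 p.2).
Proof.
have mh_dist (d' : measure_display) (T : measurableType d') (a b : T -> X) (s : T -> R) :
    measurable_fun [set: T] a -> measurable_fun [set: T] b ->
    measurable_fun [set: T] s ->
    measurable_fun [set: T] (fun w => h (mdist (a w) (b w) / s w)).
  move=> ma mb ms; apply: measurableT_comp => //.
  apply: measurable_funM; last exact: measurable_fun_inv.
  exact: (measurableT_comp m_dist (measurable_fun_pair ma mb)).
have mpow (d' : measure_display) (T : measurableType d') (s : T -> R) (q : R) :
    measurable_fun [set: T] s -> measurable_fun [set: T] (fun w => s w `^ q).
  by move=> ms; exact: (measurableT_comp (measurable_powR q)).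
have m11 : measurable_fun [set: (X * R) * X] (fun p => p.1.1).
  exact: measurableT_comp.
have m12 : measurable_fun [set: (X * R) * X] (fun p => p.1.2).
  exact: measurableT_comp.
have mphi : measurable_fun [set: X * R] (fun p => approx_phi m N h p.1 p.2).
  apply: measurable_fun_inv; apply: measurable_funM; first exact: mpow.
  apply: measurable_Rintegral_param => [p u|]; first by rewrite mulr1.
  by apply: measurable_funM => //; exact: mh_dist.
have phi_ge0 x t : 0 <= approx_phi m N h x t.
  rewrite invr_ge0 mulr_ge0 ?powR_ge0//.
  by apply: Rintegral_ge0 => u _; rewrite mulr1.
have mpsi : measurable_fun [set: X * R] (fun p => approx_psi m N h p.1 p.2).
  have mI : measurable_fun [set: X * R] (fun p => \int[m]_u
      (h (mdist p.1 u / p.2) * approx_phi m N h u p.2)).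
    apply: measurable_Rintegral_param => [p u|]; first by rewrite mulr_ge0.
    apply: measurable_funM; first exact: mh_dist.
    exact: (measurableT_comp mphi (measurable_fun_pair measurable_snd m12)).
  apply: measurable_fun_inv.
  by apply: (measurable_funM _ mI); exact: mpow.
have psi_ge0 x t : 0 <= approx_psi m N h x t.
  rewrite invr_ge0 mulr_ge0 ?powR_ge0//.
  by apply: Rintegral_ge0 => u _; rewrite mulr_ge0//; exact: phi_ge0.
have n1 : measurable_fun [set: (X * X) * R] (fun p => p.1.1).
  exact: measurableT_comp.
have n2 : measurable_fun [set: (X * X) * R] (fun p => p.1.2).
  exact: measurableT_comp.
have l12 : measurable_fun [set: (X * X * R) * X] (fun p => p.1.2).
  exact: measurableT_comp.
have mI : measurable_fun [set: X * X * R] (fun p => \int[m]_z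
    (h (mdist p.1.1 z / p.2) * h (mdist p.1.2 z / p.2) * approx_psi m N h z p.2)).
  apply: measurable_Rintegral_param => [p u|]; first by rewrite !mulr_ge0.
  apply: measurable_funM; last first.
    exact: (measurableT_comp mpsi (measurable_fun_pair measurable_snd l12)).
  apply: measurable_funM; apply: mh_dist => //.
  - exact: (measurableT_comp n1).
  - exact: (measurableT_comp n2).
apply: (measurable_funM _ mI).
apply: measurable_funM; last by apply: measurable_fun_inv; exact: mpow.
apply: measurable_funM.
  exact: (measurableT_comp mphi (measurable_fun_pair n1 measurable_snd)).
exact: (measurableT_comp mphi (measurable_fun_pair n2 measurable_snd)).
Qed.

End kernel.

(** * Integrals of powers over segments and half-lines *)

Section power_integrals.
Context {R : realType}.
Notation mu := (@lebesgue_measure R).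

(** The exponent [b] may be negative. The factor [k] lets the decreasing power of
    [integral_power_infty_le] be handled with [k = -1]. *)
Lemma integral_power_segment (k b u v : R) : 0 < u -> u < v ->
  (\int[mu]_(t in `[u, v]) (k * (b * t `^ (b - 1)))%:E =
    (k * (v `^ b - u `^ b))%:E)%E.
Proof.
move=> u0 uv.
have dF (t : R) : 0 < t -> is_derive t 1 (fun t : R => k * t `^ b) (k * (b * t `^ (b - 1))).
  by move=> t0; have := is_derive1_powR b t0 => H; exact: is_deriveZ.
have cpow (q t : R) : 0 < t -> {for t, continuous (fun t : R => t `^ q)}.
  move=> t0; apply/differentiable_continuous/derivable1_diffP.
  by have [] := is_derive1_powR q t0.
have cF (t : R) : 0 < t -> {for t, continuous (fun t : R => k * t `^ b)}.
  move=> t0; apply/differentiable_continuous/derivable1_diffP.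
  by have [] := dF t t0.
rewrite (@continuous_FTC2 _ _ (fun t : R => k * t `^ b))//.
- by rewrite -EFinB mulrBr.
- apply: continuous_in_subspaceT => t; rewrite inE/= in_itv/= => /andP[ut _].
  have t0 : 0 < t by exact: lt_le_trans ut.
  apply: cvgM; first exact: cvg_cst.
  by apply: cvgM; [exact: cvg_cst|exact: cpow].
- split.
  + move=> t; rewrite in_itv/= => /andP[ut _].
    by have [] := dF t (lt_trans u0 ut).
  + by apply: cvg_at_right_filter; exact: cF.
  + by apply: cvg_at_left_filter; apply: cF; exact: lt_trans uv.
- move=> t; rewrite in_itv/= => /andP[ut _]; rewrite derive1E.
  by have [] := dF t (lt_trans u0 ut).
Qed.

Let mpow (k q : R) (A : set R) : measurable_fun A (fun t => (k * t `^ q)%:E).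
Proof.
apply/measurable_EFinP; apply: measurable_funTS.
by apply: measurable_funM => //; exact: measurable_powR.
Qed.

Lemma integral_power0 (a D : R) : 0 < a -> 0 < D ->
  (\int[mu]_(t in `]0%R, D]) (a * t `^ (a - 1))%:E = (D `^ a)%:E)%E.
Proof.
move=> a0 D0.
(* The segments avoid the possible singularity at 0. With [n.+2] their left end is strictly below
   [D] already at [n = 0], as [integral_power_segment] requires. *)
have uE : `]0%R, D]%classic = \bigcup_n `[D / n.+2%:R, D]%classic.
  apply/seteqP; split => t; last first.
    move=> [n _]; rewrite /= !in_itv/= => /andP[Dt ->]; rewrite andbT.
    by apply: lt_le_trans Dt; rewrite divr_gt0.
  rewrite /= in_itv/= => /andP[t0 tD]; exists (Num.truncn (D / t)) => //.
  rewrite /= in_itv/= tD andbT ler_pdivrMr// mulrC -ler_pdivrMr//.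
  by apply: ltW; rewrite (lt_le_trans (truncnS_gt _))// ler_nat.
have ndF : {homo (fun n => `[D / n.+2%:R, D]%classic) : n k / (n <= k)%N >-> (n <= k)%O}.
  move=> n k nk; apply/subsetPset => t; rewrite /= !in_itv/= => /andP[nt ->].
  by rewrite andbT (le_trans _ nt)// ler_pM2l// lef_pV2 ?posrE// ler_nat.
have ge0 (n : nat) t : `[D / n.+2%:R, D]%classic t -> (0 <= (a * t `^ (a - 1))%:E)%E.
  by move=> _; rewrite lee_fin mulr_ge0 ?powR_ge0// ltW.
have mf (n : nat) : measurable_fun `[D / n.+2%:R, D]%classic (fun t => (a * t `^ (a - 1))%:E).
  exact: mpow.
have := ge0_nondecreasing_set_cvg_integral (mu := mu) ndF
  (fun n => measurable_itv _) mf ge0.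
rewrite -uE => cv.
apply: (cvg_unique _ cv); first exact: ereal_hausdorff.
have -> : (fun n : nat => \int[mu]_(t in `[(D / n.+2%:R)%R, D]) (a * t `^ (a - 1))%:E)%E =
    (fun n => (D `^ a - (D / n.+2%:R) `^ a)%:E).
  apply/funext => n; rewrite -[in RHS](mul1r (_ - _)) -integral_power_segment ?divr_gt0//.
    by apply: eq_integral => t _; rewrite mul1r.
  by rewrite ltr_pdivrMr// ltr_pMr// ltr1n.
apply: cvg_EFin; first by near=> n.
rewrite -[X in _ --> X]subr0; apply: cvgB; first exact: cvg_cst.
have /cvg_at_rightP/(_ (fun n => D / n.+2%:R)) := powR_cvg0 a0; apply; split.
  by move=> n; rewrite divr_gt0.
rewrite -(mulr0 D); apply: cvgM; first exact: cvg_cst.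
have := @cvg_harmonic R; rewrite -(cvg_shiftn 1) => H; apply: cvg_trans H.
by apply: near_eq_cvg; near=> n; rewrite /harmonic/= addn1.
Unshelve. all: by end_near. Qed.

Lemma integral_power_infty_le (b D : R) : 0 < b -> 0 < D ->
  (\int[mu]_(t in `]D, +oo[) (b * t `^ (- b - 1))%:E <= (D `^ (- b))%:E)%E.
Proof.
move=> b0 D0.
have uE : `[D, +oo[%classic = \bigcup_n `[D, D + n.+1%:R]%classic.
  apply/seteqP; split => t; last first.
    by move=> [n _]; rewrite /= !in_itv/= => /andP[->].
  rewrite /= in_itv/= andbT => Dt; exists (Num.truncn (t - D)) => //.
  by rewrite /= in_itv/= Dt -lerBlDl ltW// truncnS_gt.
have ndF : {homo (fun n => `[D, D + n.+1%:R]%classic) : n k / (n <= k)%N >-> (n <= k)%O}.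
  move=> n k nk; apply/subsetPset => t; rewrite /= !in_itv/= => /andP[-> tn].
  by rewrite (le_trans tn)// lerD2l ler_nat.
have ge0 (n : nat) t : `[D, D + n.+1%:R]%classic t -> (0 <= (b * t `^ (- b - 1))%:E)%E.
  by move=> _; rewrite lee_fin mulr_ge0 ?powR_ge0// ltW.
have fE : (fun t => (b * t `^ (- b - 1))%:E) = (fun t => (- 1 * (- b * t `^ (- b - 1)))%:E).
  by apply/funext => t; congr EFin; ring.
have mf (n : nat) : measurable_fun `[D, D + n.+1%:R]%classic (fun t => (b * t `^ (- b - 1))%:E).
  exact: mpow.
apply: (@le_trans _ _ (\int[mu]_(t in `[D, +oo[) (b * t `^ (- b - 1))%:E)%E).
  apply: ge0_subset_integral => //; first exact: mpow.
  - by move=> t _; rewrite lee_fin mulr_ge0 ?powR_ge0// ltW.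
  - by move=> t; rewrite /= !in_itv/= !andbT => /ltW.
have := ge0_nondecreasing_set_cvg_integral (mu := mu) ndF
  (fun n => measurable_itv _) mf ge0.
rewrite -uE => cv; rewrite -(cvg_lim _ cv)//.
apply: lime_le; first by apply/cvg_ex; eexists; exact: cv.
near=> n; rewrite fE integral_power_segment// ?ltrDl//.
by rewrite lee_fin mulN1r opprB lerBlDr lerDl powR_ge0.
Unshelve. all: by end_near. Qed.

(** Serves twice: with [D = 1] and both exponents [alpha] for the mass of the weight, and with
    [D = d(x, y)] for the near and far parts of the potential. The factors [a] and [b] inside the
    powers normalize the primitives. *)
Lemma integral_two_powers_le (a b k1 k2 D : R) (H : R -> \bar R) :
  0 < a -> 0 < b -> 0 < D -> 0 <= k1 -> 0 <= k2 ->
  measurable_fun (`]0, +oo[%classic : set R) H -> (forall t, 0 < t -> (0 <= H t)%E) ->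
  (forall t, 0 < t -> t <= D -> (H t <= (k1 * (a * t `^ (a - 1)))%:E)%E) ->
  (forall t, D < t -> (H t <= (k2 * (b * t `^ (- b - 1)))%:E)%E) ->
  (\int[mu]_(t in `]0%R, +oo[) H t <= (k1 * D `^ a + k2 * D `^ (- b))%:E)%E.
Proof.
move=> a0 b0 D0 k10 k20 mH H0 H1 H2.
have sE : `]0, +oo[%classic = `]0, D] `|` `]D, +oo[%classic :> set R.
  apply/seteqP; split => t; rewrite /= !in_itv/= ?andbT.
    by move=> t0; have [|] := leP t D; [left; apply/andP|right].
  by move=> [/andP[]//|]; exact: lt_trans.
have m1 : measurable_fun (`]0, D]%classic : set R) H.
  by apply: measurable_funS mH => // t; rewrite /= !in_itv/= => /andP[->].
have m2 : measurable_fun (`]D, +oo[%classic : set R) H.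
  apply: measurable_funS mH => // t; rewrite /= !in_itv/= !andbT.
  exact: lt_trans.
rewrite sE ge0_integral_setU//; last 3 first.
- by rewrite -sE.
- move=> t; rewrite -sE /= in_itv/= andbT; exact: H0.
- apply/disj_set2P/seteqP; split => // t [] /=; rewrite !in_itv/= andbT.
  by move=> /andP[_ tD]; rewrite ltNge tD.
rewrite EFinD; apply: leeD.
  rewrite EFinM -integral_power0// -ge0_integralZl_EFin//; last 2 first.
  - by move=> t _; rewrite lee_fin mulr_ge0 ?powR_ge0// ltW.
  - exact: mpow.
  apply: ge0_le_integral => //.
  - by move=> t; rewrite /= in_itv/= => /andP[t0 _]; exact: H0.
  - by apply: measurable_funeM; exact: mpow.
  - by move=> t; rewrite /= in_itv/= => /andP[t0 tD]; rewrite -EFinM H1.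
apply: (@le_trans _ _ (k2%:E * \int[mu]_(t in `]D, +oo[) (b * t `^ (- b - 1))%:E)%E).
  rewrite -ge0_integralZl_EFin//; last 2 first.
  - by move=> t _; rewrite lee_fin mulr_ge0 ?powR_ge0// ltW.
  - exact: mpow.
  apply: ge0_le_integral => //.
  - by move=> t; rewrite /= in_itv/= andbT => Dt; apply: H0; exact: lt_trans Dt.
  - by apply: measurable_funeM; exact: mpow.
  - by move=> t; rewrite /= in_itv/= andbT => Dt; rewrite -EFinM H2.
by rewrite EFinM lee_wpmul2l ?lee_fin// integral_power_infty_le.
Qed.

End power_integrals.

(** Common form of the three oscillation estimates: subtracting [f0] times the mass of [u] puts
    [|u| * |f - f0|] under the integral, with [w] a majorant of [|u|] up to the oscillation factor.
    It is applied to kernels [u] of mass 1 and to a difference of kernels, of mass 0. The bound is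
    in extended reals, as the integral of [w * g] may be infinite. *)
Lemma Rintegral_osc_le {d : measure_display} {T : measurableType d}
    {R : realType} (m : {measure set T -> \bar R}) (E : set T)
    (u f w g : T -> R) (a b f0 : R) :
  m.-negligible E -> measurable_fun [set: T] w -> measurable_fun [set: T] g ->
  (forall z, 0 <= w z) -> (forall z, 0 <= g z) -> 0 <= a -> 0 <= b ->
  m.-integrable [set: T] (EFin \o u) ->
  m.-integrable [set: T] (fun z => (u z * f z)%:E) ->
  (forall z, ~ E z -> `|u z| * `|f z - f0| <= a * (w z * g z + b * w z)) ->
  (`|\int[m]_z (u z * f z) - f0 * \int[m]_z u z|%:E <=
    a%:E * (\int[m]_z (w z * g z)%:E + b%:E * \int[m]_z (w z)%:E))%E.
Proof.
move=> nE mw mg w0 g0 a0 b0 iu iuf H.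
have iu0 : m.-integrable [set: T] (EFin \o (fun z => f0 * u z)).
  exact: (integrableZl measurableT f0 iu).
have iD : m.-integrable [set: T] (EFin \o (fun z => u z * f z - f0 * u z)).
  exact: (integrableB measurableT iuf iu0).
have mwg : measurable_fun [set: T] (fun z => (w z * g z)%:E).
  by apply/measurable_EFinP; exact: measurable_funM.
have mbw : measurable_fun [set: T] (fun z => (b * w z)%:E).
  by apply/measurable_EFinP; exact: measurable_funM.
rewrite -RintegralZl// -RintegralB// EFin_normr_Rintegral//.
apply: (le_trans (le_abse_integral _ _ _)) => //; first exact: measurable_int iD.
rewrite -[X in (_ <= _ * (_ + X))%E]ge0_integralZl_EFin//; last 2 first.
- by move=> z _; rewrite lee_fin.
- exact/measurable_EFinP.
rewrite -ge0_integralD//; last 2 first.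
- by move=> z _; rewrite lee_fin mulr_ge0.
- by move=> z _; rewrite lee_fin mulr_ge0.
rewrite -ge0_integralZl_EFin//; last 2 first.
- by move=> z _; rewrite -EFinD lee_fin addr_ge0// mulr_ge0.
- exact: emeasurable_funD.
apply: ae_ge0_le_integral => //.
- by apply: measurableT_comp => //; exact: measurable_int iD.
- by move=> z _; rewrite -EFinD lee_fin mulr_ge0// addr_ge0// mulr_ge0.
- by apply: measurable_funeM; exact: emeasurable_funD.
case: nE => A [mA A0 EA]; exists A; split => // z /= nz; apply: EA.
apply: contrapT => /H Hz; apply: nz => _.
by rewrite -EFinD -EFinM lee_fin [f0 * _]mulrC -mulrBr normrM.
Qed.

(** * Oscillation of averages *)

Section smoothing.
Context {R : realType} {d : measure_display} {X : borelMetricType d R}.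
Variables (m : {sigma_finite_measure set X -> \bar R}) (N c K beta : R).
Variable s : X -> X -> R -> R.
Hypothesis c_gt0 : 0 < c.
Hypothesis m_ball : forall (x : X) (r : R), 0 < r ->
  ((c^-1 * r `^ N)%:E <= m (ball x r))%E /\ (m (ball x r) <= (c * r `^ N)%:E)%E.
Hypothesis K_gt0 : 0 < K.
Hypothesis s_ge0 : forall x z t, 0 < t -> 0 <= s x z t.
Hypothesis s_bound : forall x z t, 0 < t -> s x z t <= K / t `^ N * \1_(ball x (4 * t)) z.
Hypothesis s_lipschitz : forall x y z t, 0 < t ->
  `|s x z t - s y z t| <= K * (mdist x y / t) / t `^ N.
Hypothesis s_mass : forall x t, 0 < t -> (\int[m]_z (s x z t)%:E = 1)%E.
Hypothesis s_meas : measurable_fun [set: (X * X) * R] (fun p => s p.1.1 p.1.2 p.2).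
Hypothesis beta_ge0 : 0 <= beta.

(** [G] plays the role of a finite value of the maximal function of [g] at [x], kept as a real
    number so that the kernel estimates stay among reals. *)
Definition ball_growth (g : X -> R) (x : X) (G : R) := forall r, 0 < r ->
  (\int[m]_(z in ball x r) `|(g z)%:E| <= (r `^ N * G)%:E)%E.

Lemma ball_growth_ge0 g x G : ball_growth g x G -> 0 <= G.
Proof.
move=> /(_ 1 ltr01); rewrite powR1 mul1r => H.
rewrite -lee_fin (le_trans _ H)//; exact: integral_ge0.
Qed.

Definition smooth (f : X -> R) (t : R) (x : X) : R := \int[m]_z (s x z t * f z).

Let s_meas1 x t : measurable_fun [set: X] (fun z => s x z t).
Proof.
have H : measurable_fun [set: X] (fun z : X => ((x, z), t)).
  by apply: measurable_fun_pair => //; exact: measurable_fun_pair.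
exact: (measurableT_comp s_meas H).
Qed.

Let s_integrable x t : 0 < t -> m.-integrable [set: X] (EFin \o (fun z => s x z t)).
Proof.
move=> t0; apply/integrableP; split; first exact/measurable_EFinP.
under eq_integral => z _ do rewrite /= ger0_norm ?s_ge0//.
by rewrite s_mass// ltry.
Qed.

Let s_Rmass x t : 0 < t -> \int[m]_z s x z t = 1.
Proof. by move=> t0; rewrite /Rintegral s_mass. Qed.

Let s0 x z t : 0 < t -> 4 * t <= mdist x z -> s x z t = 0.
Proof.
move=> t0 xz; apply/eqP; rewrite eq_le s_ge0// andbT.
apply: (le_trans (s_bound _ _ t0)); rewrite indicE memNset ?mulr0//.
by rewrite ballEmdist/=; apply/negP; rewrite -leNgt.
Qed.

Lemma smooth_le x t (F : X -> R) : 0 < t -> measurable_fun [set: X] F ->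
  (\int[m]_z `|(s x z t * F z)%:E| <=
    (K / t `^ N)%:E * \int[m]_(z in ball x (4 * t)) `|(F z)%:E|)%E.
Proof.
move=> t0 mF; have mb := measurable_metric_ball x (4 * t).
rewrite [in leRHS]integral_mkcond -ge0_integralZl_EFin//; last 3 first.
- by move=> z _; rewrite erestrict_ge0.
- apply/(measurable_restrictT _ mb).
  by apply: measurableT_comp => //; apply: measurable_funTS; exact/measurable_EFinP.
- by rewrite divr_ge0 ?powR_ge0 ?ltW.
have mFe : measurable_fun [set: X] (fun z => `|(F z)%:E|)%E.
  by apply: measurableT_comp => //; exact/measurable_EFinP.
apply: ge0_le_integral => //.
- apply: measurableT_comp => //; apply/measurable_EFinP.
  exact: measurable_funM.
- apply: measurable_funeM; apply/(measurable_restrictT _ mb).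
  exact: measurable_funTS.
move=> z _; rewrite patchE abse_EFin normrM ger0_norm ?s_ge0//.
have /= := s_bound x z t0; rewrite indicE.
case: ifPn => [_|_]; rewrite ?mulr1 ?mulr0 => sK.
  by rewrite /= -EFinM lee_fin ler_wpM2r.
by rewrite mule0 lee_fin mulr_le0_ge0.
Qed.

Lemma smooth_growth x t g G : 0 < t -> measurable_fun [set: X] g ->
  ball_growth g x G ->
  (\int[m]_z `|(s x z t * g z)%:E| <= (K * 4 `^ N * G)%:E)%E.
Proof.
move=> t0 mg gG; apply: (le_trans (smooth_le x t0 mg)).
have Kt : 0 <= K / t `^ N by rewrite divr_ge0 ?powR_ge0 ?ltW.
have t4 : 0 < 4 * t by rewrite mulr_gt0.
apply: (le_trans (lee_wpmul2l _ (gG _ t4))); first by rewrite lee_fin.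
rewrite -EFinM lee_fin powRM ?(ltW t0)//.
rewrite le_eqVlt; apply/orP; left; apply/eqP; field.
by rewrite gt_eqF// powR_gt0.
Qed.

Section hajlasz.
Variables (f g : X -> R) (E : set X).
Hypothesis mf : measurable_fun [set: X] f.
Hypothesis mg : measurable_fun [set: X] g.
Hypothesis g_ge0 : forall x, 0 <= g x.
Hypothesis nE : m.-negligible E.
Hypothesis fg : forall x y, ~ E x -> ~ E y ->
  `|f x - f y| <= mdist x y `^ beta * (g x + g y).
Hypothesis m_infty : m [set: X] = +oo%E.

Let point_notin : exists w, ~ E w.
Proof.
apply: contrapT => /forallNP nw.
have ET : E = [set: X] by apply/seteqP; split => // x _; exact: contrapT (nw x).
have := nE; rewrite ET => /negligibleP => /(_ measurableT).
by rewrite /= m_infty.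
Qed.

(** Comparison with a point [w] off [E]: for almost every [z] in the ball,
    [|f z| <= |f w| + a * (g z + g w)] with [a = (r + d(x, w))^beta], and the growth bound makes [g]
    integrable there. *)
Let locally_integrable x G r : ball_growth g x G ->
  (\int[m]_(z in ball x r) `|(f z)%:E| < +oo)%E.
Proof.
move=> gG; have [w nw] := point_notin.
have mb := measurable_metric_ball x r.
have [r0|r0] := ltP 0 r; last first.
  rewrite (_ : ball x r = set0) ?integral_set0 ?ltry//.
  by apply/seteqP; split => // y; rewrite ballEmdist/= ltNge (le_trans r0)// mdist_ge0.
pose a := (r + mdist x w) `^ beta.
have a0 : 0 <= a by exact: powR_ge0.
have mge : measurable_fun (ball x r) (fun z => `|(g z)%:E|)%E.
  by apply: measurableT_comp => //; apply: measurable_funTS; exact/measurable_EFinP.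
apply: (@le_lt_trans _ _ (\int[m]_(z in ball x r)
    ((`|f w| + a * g w)%:E + a%:E * `|(g z)%:E|)%E)%E).
  apply: ae_ge0_le_integral => //.
  - by apply: measurableT_comp => //; apply: measurable_funTS; exact/measurable_EFinP.
  - move=> z _; rewrite abse_EFin -EFinM -EFinD lee_fin addr_ge0//.
      by rewrite addr_ge0// mulr_ge0.
    by rewrite mulr_ge0.
  - by apply: emeasurable_funD => //; exact: measurable_funeM.
  case: nE => A [mA A0 EA]; exists A; split => // z /= nz; apply: EA.
  apply: contrapT => Ez; apply: nz; rewrite ballEmdist/= => xz.
  rewrite -EFinM -EFinD lee_fin.
  have dzw : mdist z w `^ beta <= a.
    apply: ge0_ler_powR => //; rewrite ?nnegrE ?mdist_ge0 ?addr_ge0 ?mdist_ge0 ?ltW//.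
    have := metric_triangle z x w; rewrite (metric_sym z x); lra.
  have := fg Ez nw; have := ler_normD (f z - f w) (f w); rewrite subrK.
  have : mdist z w `^ beta * (g z + g w) <= a * (g z + g w).
    by rewrite ler_wpM2r// addr_ge0.
  rewrite (ger0_norm (g_ge0 z)); lra.
rewrite ge0_integralD//; last 3 first.
- by move=> z _; rewrite lee_fin addr_ge0// mulr_ge0.
- by move=> z _; rewrite abse_EFin -EFinM lee_fin mulr_ge0.
- exact: measurable_funeM.
rewrite ge0_integralZl_EFin//; rewrite integral_cst//.
apply: lte_add_pinfty.
  apply: lte_mul_pinfty => //; first by rewrite lee_fin addr_ge0// mulr_ge0.
  by rewrite (le_lt_trans (m_ball x r0).2)// ltry.
apply: lte_mul_pinfty => //.
by rewrite (le_lt_trans (gG _ r0))// ltry.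
Qed.

Lemma smooth_integrable x t G : 0 < t -> ball_growth g x G ->
  m.-integrable [set: X] (fun z => (s x z t * f z)%:E).
Proof.
move=> t0 gG; apply/integrableP; split.
  by apply/measurable_EFinP; exact: measurable_funM.
apply: (le_lt_trans (smooth_le x t0 mf)); apply: lte_mul_pinfty => //.
  by rewrite lee_fin divr_ge0 ?powR_ge0 ?ltW.
exact: locally_integrable gG.
Qed.

Let Q := K * 4 `^ N.
Let Q_ge0 : 0 <= Q. Proof. by rewrite mulr_ge0 ?powR_ge0 ?ltW. Qed.

Let smooth_growth_ge0 x t G : 0 < t -> ball_growth g x G ->
  (\int[m]_z (s x z t * g z)%:E <= (Q * G)%:E)%E.
Proof.
move=> t0 gG; apply: le_trans (smooth_growth t0 mg gG).
rewrite le_eqVlt; apply/orP; left; apply/eqP; apply: eq_integral => z _.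
by rewrite abse_EFin ger0_norm// mulr_ge0// s_ge0.
Qed.

Let dist_beta a b : 0 <= a -> a <= b -> a `^ beta <= b `^ beta.
Proof. by move=> a0 ab; apply: ge0_ler_powR; rewrite ?nnegrE// (le_trans a0). Qed.

(** The average at [y] is compared with [f z], where [z] will be an integration variable: the
    remaining pointwise term [g z] is then averaged in its turn. *)
Lemma smooth_osc z y t G : ~ E z -> 0 < t -> ball_growth g y G ->
  `|f z - smooth f t y| <= (mdist z y + 4 * t) `^ beta * (g z + Q * G).
Proof.
move=> Ez t0 gG.
have := @Rintegral_osc_le _ _ _ m E (fun w => s y w t) f (fun w => s y w t) g
  ((mdist z y + 4 * t) `^ beta) (g z) (f z) nE (s_meas1 y t) mg
  (fun w => s_ge0 y w t0) g_ge0 (powR_ge0 _ _) (g_ge0 z) (s_integrable y t0)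
  (smooth_integrable t0 gG).
rewrite s_mass// s_Rmass// mulr1 mule1 distrC => H.
rewrite -lee_fin; apply: le_trans; first apply: H.
  move=> w Ew; rewrite (ger0_norm (s_ge0 _ _ t0)).
  have [yw|yw] := ltP (mdist y w) (4 * t); last by rewrite s0// !mul0r mulr0 addr0 mulr0.
  rewrite [X in _ <= _ * (_ + X)]mulrC -mulrDr mulrCA ler_wpM2l ?s_ge0//.
  apply: (le_trans (fg Ew Ez)); rewrite ler_wpM2r ?addr_ge0//.
  apply: dist_beta; first exact: mdist_ge0.
  have := metric_triangle w y z; rewrite (metric_sym w y) (metric_sym y z); lra.
rewrite EFinM lee_wpmul2l ?lee_fin ?powR_ge0// [in leRHS]addrC EFinD leeD2r//.
exact: smooth_growth_ge0.
Qed.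

(** Integrate [smooth_osc] in [w] against [s(x, ., t)]. On its support [d(w, y) + 4 * t < 4 * t + D
    + 4 * t <= 9 * D], which explains the constant 9. *)
Lemma smooth_diff_near x y t D Gx Gy : 0 < t -> t <= D -> mdist x y <= D ->
  ball_growth g x Gx -> ball_growth g y Gy ->
  `|smooth f t x - smooth f t y| <= (9 * D) `^ beta * (Q * (Gx + Gy)).
Proof.
move=> t0 tD xyD gx gy; have Gy0 := ball_growth_ge0 gy.
have := @Rintegral_osc_le _ _ _ m E (fun w => s x w t) f (fun w => s x w t) g
  ((9 * D) `^ beta) (Q * Gy) (smooth f t y) nE (s_meas1 x t) mg
  (fun w => s_ge0 x w t0) g_ge0 (powR_ge0 _ _) (mulr_ge0 Q_ge0 Gy0)
  (s_integrable x t0) (smooth_integrable t0 gx).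
rewrite s_mass// s_Rmass// mulr1 mule1 => H.
rewrite -lee_fin; apply: le_trans; first apply: H.
  move=> w Ew; rewrite (ger0_norm (s_ge0 _ _ t0)).
  have [xw|xw] := ltP (mdist x w) (4 * t); last by rewrite s0// !mul0r mulr0 addr0 mulr0.
  rewrite [X in _ <= _ * (_ + X)]mulrC -mulrDr mulrCA ler_wpM2l ?s_ge0//.
  apply: (le_trans (smooth_osc Ew t0 gy)).
  apply: ler_wpM2r; first by rewrite addr_ge0// mulr_ge0.
  apply: dist_beta; first by rewrite addr_ge0 ?mdist_ge0// mulr_ge0// ltW.
  have := metric_triangle w x y; rewrite (metric_sym w x); lra.
rewrite [in leRHS]EFinM lee_wpmul2l ?lee_fin ?powR_ge0// mulrDr EFinD leeD2r//.
exact: smooth_growth_ge0.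
Qed.

(** The difference of kernels has integral 0, so [S_t f(y)] may be subtracted from [f]. Both kernels
    vanish outside [ball y (5 * t)], since [4 * t + d(x, y) <= 5 * t]; hence the majorant [w], the
    Lipschitz bound cut off to that ball. There [smooth_osc] costs [(5 * t + 4 * t)^beta]. In
    [1 + Q * c], the first term comes from [g z] and the second from the average of [g] at [y]. *)
Lemma smooth_diff_far x y t Gx Gy : 0 < t -> mdist x y <= t ->
  ball_growth g x Gx -> ball_growth g y Gy ->
  `|smooth f t x - smooth f t y| <=
    9 `^ beta * K * 5 `^ N * (1 + Q * c) * (mdist x y * t `^ (beta - 1) * Gy).
Proof.
move=> t0 xyt gx gy; have Gy0 := ball_growth_ge0 gy.
have t5 : 0 < 5 * t by rewrite mulr_gt0.
have mb := measurable_metric_ball y (5 * t).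
pose k := K * (mdist x y / t) / t `^ N.
have k0 : 0 <= k.
  by rewrite /k !mulr_ge0 ?invr_ge0 ?powR_ge0 ?mdist_ge0// ?ltW// ltW.
pose w z : R := k * \1_(ball y (5 * t)) z.
have w0 z : 0 <= w z by rewrite mulr_ge0.
have mw : measurable_fun [set: X] w.
  by apply: measurable_funM => //; exact: measurable_indic.
have ixf := smooth_integrable t0 gx; have iyf := smooth_integrable t0 gy.
have iu : m.-integrable [set: X] (EFin \o (fun z => s x z t - s y z t)).
  exact: (integrableB measurableT (s_integrable x t0) (s_integrable y t0)).
have iuf : m.-integrable [set: X] (fun z => ((s x z t - s y z t) * f z)%:E).
  have := integrableB measurableT ixf iyf; apply: eq_integrable => // z _.
  by rewrite /= mulrBl EFinB.
have := @Rintegral_osc_le _ _ _ m E (fun z => s x z t - s y z t) f w g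
  ((9 * t) `^ beta) (Q * Gy) (smooth f t y) nE mw mg w0 g_ge0 (powR_ge0 _ _)
  (mulr_ge0 Q_ge0 Gy0) iu iuf.
have -> : \int[m]_z (s x z t - s y z t) = 0.
  by rewrite RintegralB ?s_Rmass ?subrr//; exact: s_integrable.
have -> : \int[m]_z ((s x z t - s y z t) * f z) = smooth f t x - smooth f t y.
  by rewrite -RintegralB//; apply: eq_Rintegral => z _; rewrite mulrBl.
rewrite mulr0 subr0 => H.
rewrite -lee_fin; apply: le_trans; first apply: H.
  move=> z Ez; rewrite [X in _ <= _ * (_ + X)]mulrC -mulrDr mulrCA.
  have := s_lipschitz x y z t0; rewrite -/k => sk.
  have [yz|yz] := ltP (mdist y z) (5 * t); last first.
    have x0 : s x z t = 0.
      by apply: s0 => //; have := metric_triangle y x z; rewrite (metric_sym y x); lra.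
    have y0 : s y z t = 0 by apply: s0 => //; lra.
    rewrite x0 y0 subrr normr0 mul0r mulr_ge0// mulr_ge0 ?powR_ge0//.
    by rewrite addr_ge0// mulr_ge0.
  rewrite /w indicE mem_set ?mulr1; last by rewrite ballEmdist.
  apply: ler_pM => //.
  apply: (le_trans (smooth_osc Ez t0 gy)).
  apply: ler_wpM2r; first by rewrite addr_ge0// mulr_ge0.
  apply: dist_beta; first by rewrite addr_ge0 ?mdist_ge0// mulr_ge0// ltW.
  by rewrite (metric_sym z y); lra.
have wint (F : X -> R) : measurable_fun [set: X] F -> (forall z, 0 <= F z) ->
    (\int[m]_z (w z * F z)%:E = k%:E * \int[m]_(z in ball y (5 * t)) `|(F z)%:E|)%E.
  move=> mF F0; rewrite [in RHS]integral_mkcond -ge0_integralZl_EFin//; last 2 first.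
  - by move=> z _; rewrite erestrict_ge0.
  - apply/(measurable_restrictT _ mb).
    by apply: measurableT_comp => //; apply: measurable_funTS; exact/measurable_EFinP.
  apply: eq_integral => z _; rewrite patchE /w indicE.
  by case: ifPn => _; rewrite ?mulr1 ?mulr0 ?mul0r ?mule0// abse_EFin ger0_norm.
rewrite wint// (_ : (\int[m]_z (w z)%:E = k%:E * m (ball y (5 * t)))%E); last first.
  transitivity (\int[m]_z (w z * 1)%:E)%E.
    by apply: eq_integral => z _; rewrite mulr1.
  rewrite wint//; congr (_ * _)%E.
  under eq_integral do rewrite abse_EFin normr1.
  by rewrite integral_cst// mul1e.
apply: (@le_trans _ _ (((9 * t) `^ beta)%:E * (k%:E * ((5 * t) `^ N * Gy)%:E +
    (Q * Gy)%:E * (k%:E * (c * (5 * t) `^ N)%:E))))%E.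
  apply: lee_wpmul2l; first by rewrite lee_fin powR_ge0.
  apply: leeD; first by rewrite lee_wpmul2l ?lee_fin//; exact: gy.
  apply: lee_wpmul2l; first by rewrite lee_fin mulr_ge0.
  apply: lee_wpmul2l; first by rewrite lee_fin.
  exact: (m_ball _ t5).2.
rewrite -!EFinM lee_fin /k !powRM ?(ltW t0)// powRB; last first.
  by apply/implyP => _; rewrite gt_eqF.
rewrite powRr1 ?(ltW t0)// le_eqVlt; apply/orP; left; apply/eqP; field.
by rewrite !gt_eqF// powR_gt0.
Qed.

End hajlasz.

End smoothing.

(** The local estimates are summed over the disjoint [B i]. In the weak-type inequality these are
    the Vitali balls and the [A i] their dilates. The sum is transported to the integers by an
    injection, with empty sets at indices outside its image. *)
Lemma measure_bigcup_le_integral {d : measure_display} {T : measurableType d}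
    {R : realType} (m : {measure set T -> \bar R}) (I : pointedType)
    (D : set I) (A B : I -> set T) (phi : T -> \bar R) : countable D ->
  measurable_fun [set: T] phi -> (forall x, (0 <= phi x)%E) -> trivIset D B ->
  (forall i, D i -> [/\ measurable (A i), measurable (B i) &
    (m (A i) <= \int[m]_(x in B i) phi x)%E]) ->
  (m (\bigcup_(i in D) A i) <= \int[m]_x phi x)%E.
Proof.
move=> /countable_injP[f injf] mphi phi0 tB H.
pose p n := 'pinv_(fun=> point) D f n.
pose A' n := if n \in f @` D then A (p n) else set0.
pose B' n := if n \in f @` D then B (p n) else set0.
have pD n : n \in f @` D -> D (p n) /\ f (p n) = n.
  by rewrite inE => -[i Di <-]; rewrite /p pinvKV ?inE.
have mA' n : measurable (A' n).
  by rewrite /A'; case: ifPn => // /pD[/H[]].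
have mB' n : measurable (B' n).
  by rewrite /B'; case: ifPn => // /pD[/H[]].
have AA' : \bigcup_(i in D) A i `<=` \bigcup_n A' n.
  move=> x [i Di Aix]; exists (f i) => //; rewrite /A' mem_set; last by exists i.
  by rewrite /p pinvKV ?inE.
have AE : \bigcup_(i in D) A i = \bigcup_n A' n.
  apply/seteqP; split => // x [n _]; rewrite /A'; case: ifPn => // /pD[Dp _] Apx.
  by exists (p n).
have tB' : trivIset [set: nat] B'.
  move=> i j _ _; rewrite /B'.
  case: ifPn => [/pD[Di fi]|_ [x []//]]; case: ifPn => [/pD[Dj fj]|_ [x []//]].
  by move=> /tB pij; rewrite -fi -fj pij.
rewrite AE; apply: (le_trans (generalized_Boole_inequality _ mA' _)).
  exact: bigcup_measurable.
apply: (@le_trans _ _ (\int[m]_(x in \bigcup_n B' n) phi x)%E); last first.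
  by apply: ge0_subset_integral => //; exact: bigcup_measurable.
rewrite ge0_integral_bigcup//; last exact: measurable_funTS.
apply: lee_nneseries => // n _; rewrite /A' /B'; case: ifPn => [/pD[/H[]]//|_].
by rewrite measure0 integral_set0.
Qed.

(** * Tonelli over positive times *)

Section tonelli_positive.
Context {d : measure_display} {T : measurableType d} {R : realType}.
Variables (m : {sigma_finite_measure set T -> \bar R}) (F : T -> R -> \bar R).
Hypothesis mF : measurable_fun [set: T * R] (fun p => F p.1 p.2).
Hypothesis F0 : forall x l, 0 < l -> (0 <= F x l)%E.
Notation mu := (@lebesgue_measure R).

Let D : set (T * R) := [set: T] `*` `]0, +oo[.
(** [F] has no prescribed sign at times [l <= 0], so Tonelli is applied to its extension by zero
    from the positive times. *)
Let G (p : T * R) := ((fun p => F p.1 p.2) \_ D) p.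

Let mD : measurable D. Proof. exact: measurableX. Qed.

Let mG : measurable_fun [set: T * R] G.
Proof. by apply/(measurable_restrictT _ mD); exact: measurable_funTS. Qed.

Let G0 p : (0 <= G p)%E.
Proof.
rewrite /G patchE; case: ifPn => //; rewrite inE => -[_]/=.
by rewrite in_itv/= andbT; exact: F0.
Qed.

Let GE x : (\int[mu]_(l in `]0%R, +oo[) F x l = \int[mu]_l G (x, l))%E.
Proof.
rewrite integral_mkcond; apply: eq_integral => l _; rewrite /G !patchE.
by congr (if _ then _ else _); apply/idP/idP; rewrite !inE /D/=; [split|case].
Qed.

Let GE2 l : 0 < l -> (\int[m]_x F x l = \int[m]_x G (x, l))%E.
Proof.
move=> l0; apply: eq_integral => x _; rewrite /G patchE mem_set//.
by split => //=; rewrite in_itv/= l0.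
Qed.

Lemma tonelli_positive :
  (\int[m]_x \int[mu]_(l in `]0%R, +oo[) F x l =
   \int[mu]_(l in `]0%R, +oo[) \int[m]_x F x l)%E.
Proof.
transitivity (\int[m]_x \int[mu]_l G (x, l))%E.
  by apply: eq_integral => x _; exact: GE.
rewrite (@fubini_tonelli _ _ _ _ _ m mu G mG G0).
rewrite [RHS]integral_mkcond; apply: eq_integral => l _.
rewrite patchE; case: ifPn => [|nl]; rewrite ?inE/= ?in_itv/= ?andbT.
  by move=> l0; rewrite GE2.
apply: integral0_eq => x _; rewrite /G patchE memNset//= => -[_]/=.
by move: nl; rewrite notin_setE.
Qed.

Lemma measurable_integral_positive :
  measurable_fun [set: T] (fun x => \int[mu]_(l in `]0%R, +oo[) F x l)%E.
Proof.
have mI := @measurable_fun_fubini_tonelli_F _ _ _ _ _ mu G mG G0.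
by apply: eq_measurable_fun mI => x _; rewrite /fubini_F GE.
Qed.

Lemma measurable_positive_integral :
  measurable_fun (`]0, +oo[%classic : set R) (fun l => \int[m]_x F x l)%E.
Proof.
apply: (@eq_measurable_fun _ _ _ _ _ (fun l => \int[m]_x G (x, l))%E).
  by move=> l; rewrite inE/= in_itv/= andbT => l0; rewrite GE2.
by apply: measurable_funTS; exact: (@measurable_fun_fubini_tonelli_G _ _ _ _ _ m G mG G0).
Qed.

End tonelli_positive.

(** * The maximal theorem *)

Section maximal.
Context {R : realType} {d : measure_display} {X : borelMetricType d R}.
Variables (m : {sigma_finite_measure set X -> \bar R}) (N c : R).
Hypothesis N_gt0 : 0 < N.
Hypothesis c_gt0 : 0 < c.
Hypothesis m_ball : forall (x : X) (r : R), 0 < r ->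
  ((c^-1 * r `^ N)%:E <= m (ball x r))%E /\ (m (ball x r) <= (c * r `^ N)%:E)%E.

(* Comparable to [maximal_function], and lower semicontinuous, hence Borel. *)
Definition ahlfors_maximal (g : X -> R) (x : X) : \bar R :=
  ereal_sup [set (((r `^ N)^-1)%R%:E * \int[m]_(y in ball x r) `|(g y)%:E|)%E
            | r in `]0, +oo[%classic].

Let meas_abs (g : X -> R) (A : set X) : measurable_fun [set: X] g ->
  measurable_fun A (fun y => `|(g y)%:E|)%E.
Proof.
move=> mg; apply: measurable_funTS; apply: measurableT_comp => //.
exact/measurable_EFinP.
Qed.

Lemma ahlfors_maximal_ge0 g x : (0 <= ahlfors_maximal g x)%E.
Proof.
apply: le_ereal_sup_tmp; eexists; first by exists 1 => //=; rewrite in_itv/= ltr01.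
by rewrite mule_ge0 ?integral_ge0// lee_fin invr_ge0 powR_ge0.
Qed.

Lemma integral_le_ahlfors_maximal g x r : 0 < r ->
  (\int[m]_(y in ball x r) `|(g y)%:E| <= (r `^ N)%:E * ahlfors_maximal g x)%E.
Proof.
move=> r0; have rN : 0 < r `^ N by exact: powR_gt0.
rewrite -lee_pdivrMl// /ahlfors_maximal; apply: ereal_sup_ubound.
by exists r => //=; rewrite in_itv/= r0.
Qed.

(** The upper mass bound gives [r^(-N) <= c / m(B(x, r))]. The lower one makes the measure nonzero,
    so that the extended inverse in [maximal_function] is a real inverse. *)
Lemma ahlfors_maximal_le_maximal_function g x : measurable_fun [set: X] g ->
  (ahlfors_maximal g x <= c%:E * maximal_function m g x)%E.
Proof.
move=> mg; apply: ge_ereal_sup => _ [r /= + <-]; rewrite in_itv/= andbT => r0.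
have rN : 0 < r `^ N by exact: powR_gt0.
have mfin : m (ball x r) \is a fin_num.
  by rewrite ge0_fin_numE// (le_lt_trans (m_ball x r0).2)// ltry.
have [mlo mhi] := m_ball x r0.
have m0 : 0 < fine (m (ball x r)).
  rewrite -lte_fin fineK//; apply: lt_le_trans mlo.
  by rewrite lte_fin mulr_gt0// invr_gt0.
apply: (@le_trans _ _ (c%:E * ((m (ball x r))^-1 * \int[m]_(y in ball x r) `|(g y)%:E|))%E).
  rewrite muleA lee_wpmul2r ?integral_ge0//.
  rewrite -(fineK mfin) inver gt_eqF// -EFinM lee_fin.
  rewrite ler_pdivlMr// mulrC ler_pdivrMr//.
  by rewrite -lee_fin fineK.
rewrite lee_wpmul2l ?lee_fin ?(ltW c_gt0)// /maximal_function; apply: ereal_sup_ubound.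
by exists r => //=; rewrite in_itv/= r0.
Qed.

(** If the average on [ball x r] exceeds [a], then by monotone convergence so does the integral over
    some [ball x (r - e)] divided by the same [r^N]. That ball lies in [ball y r] whenever
    [d(x, y) < e]. The normalization being independent of the centre is essential here. *)
Lemma ahlfors_maximal_open g (a : R) : measurable_fun [set: X] g ->
  open [set x | (a%:E < ahlfors_maximal g x)%E].
Proof.
move=> mg; rewrite openE => x /= /ereal_sup_gt[_ [r /= + <-]].
rewrite in_itv/= andbT => r0 ar.
have rN : 0 < r `^ N by exact: powR_gt0.
pose e n := r / n.+1%:R.
have e0 n : 0 < e n by rewrite divr_gt0.
have uE : ball x r = \bigcup_n ball x (r - e n).
  apply/seteqP; split => y; last first.
    by move=> [n _]; rewrite !ballEmdist/= => /lt_trans; apply; rewrite ltrBlDr ltrDl.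
  rewrite ballEmdist/= => xy; pose k := Num.truncn (r / (r - mdist x y)).
  exists k => //; rewrite ballEmdist/= ltrBrDr addrC -ltrBrDr ltr_pdivrMr//.
  by rewrite mulrC -ltr_pdivrMr ?subr_gt0// truncnS_gt.
have ndF : {homo (fun n : nat => (ball x (r - e n) : set X)) : n k / (n <= k)%N >-> (n <= k)%O}.
  move=> n k nk; apply/subsetPset => y; rewrite !ballEmdist/= => /lt_le_trans; apply.
  by rewrite lerB// ler_pM2l// lef_pV2 ?posrE// ler_nat.
have cv := ge0_nondecreasing_set_cvg_integral (mu := m) ndF
  (fun n => measurable_metric_ball _ _) (fun n => @meas_abs g _ mg)
  (fun n y _ => abse_ge0 (g y)%:E).
have [n en] : exists n, (a%:E < ((r `^ N)^-1)%R%:E * \int[m]_(y in ball x (r - e n)) `|(g y)%:E|)%E.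
  apply: contrapT => /forallNP H; move: ar; apply/negP; rewrite -leNgt.
  rewrite lee_pdivrMl// uE -(cvg_lim _ cv)//.
  apply: lime_le; first by apply/cvg_ex; eexists; exact: cv.
  by near=> n; rewrite -lee_pdivrMl// leNgt; exact/negP/H.
apply/nbhs_ballP; exists (e n) => //= y xy.
apply: (lt_le_trans en); apply: le_ereal_sup_tmp; eexists.
  by exists r => //=; rewrite in_itv/= r0.
rewrite lee_wpmul2l ?lee_fin ?invr_ge0 ?powR_ge0//.
apply: ge0_subset_integral => //.
- exact: measurable_metric_ball.
- exact: measurable_metric_ball.
- exact: meas_abs.
move=> z xz; have := ball_triangle (ball_sym xy) xz.
by rewrite addrC subrK.
Unshelve. all: by end_near. Qed.

Lemma measurable_ahlfors_maximal g : measurable_fun [set: X] g ->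
  measurable_fun [set: X] (ahlfors_maximal g).
Proof.
move=> mg; apply: (measurability _ (ErealGenOInfty.measurableE R)) => //.
move=> _ [_ [a ->] <-]; rewrite setTI.
rewrite (_ : _ @^-1` _ = [set x | (a%:E < ahlfors_maximal g x)%E]).
  exact/borel_open_measurable/ahlfors_maximal_open.
by apply/seteqP; split => x /=; rewrite in_itv/= andbT.
Qed.

(** Each point of the superlevel set has a ball with [l * r^N] below the integral of [|g|]. The
    Vitali balls are disjoint, so these integrals add up, and their dilates by 5 cover the set at a
    cost of [c * 5^N]. *)
Lemma ahlfors_maximal_weak_type g (l : R) : measurable_fun [set: X] g -> 0 < l ->
  (m [set x | l%:E < ahlfors_maximal g x] <=
    (c * 5 `^ N / l)%:E * \int[m]_x `|(g x)%:E|)%E.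
Proof.
move=> mg l0; set E := [set x | _].
have C0 : 0 < c * 5 `^ N / l by rewrite divr_gt0// mulr_gt0// powR_gt0.
have [goo|gfin] := eqVneq (\int[m]_x `|(g x)%:E|)%E +oo%E.
  by rewrite goo gt0_muley ?leey// lte_fin.
have [[x0 Ex0]|E0] := pselect (E !=set0); last first.
  have -> : E = set0 by apply/seteqP; split => // x Ex; case: E0; exists x.
  by rewrite measure0 mule_ge0 ?integral_ge0// lee_fin ltW.
have {}gfin : (\int[m]_x `|(g x)%:E|)%E \is a fin_num.
  by rewrite ge0_fin_numE ?integral_ge0// ltey.
have /choice[r Hr] : forall x, exists r, E x ->
    0 < r /\ ((l * r `^ N)%:E < \int[m]_(y in ball x r) `|(g y)%:E|)%E.
  move=> x; have [|nEx] := pselect (E x); last by exists 0.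
  move=> /ereal_sup_gt[_ [r /= + <-]]; rewrite in_itv/= andbT => r0 lr.
  exists r => _; split => //; move: lr.
  by rewrite lte_pdivlMl ?powR_gt0// -EFinM mulrC.
pose I := fine (\int[m]_x `|(g x)%:E|)%E.
(* The Vitali lemma needs bounded radii: [l * r^N < I] with [I] finite bounds them. *)
pose R0 := (I / l) `^ N^-1.
have rR0 x : E x -> 0 < r x <= R0.
  move=> /Hr[r0 lr]; rewrite r0/=.
  have rI : r x `^ N <= I / l.
    rewrite ler_pdivlMr// mulrC -lee_fin fineK//; apply/ltW/(lt_le_trans lr).
    by apply: ge0_subset_integral => //; [exact: measurable_metric_ball|exact: meas_abs].
  have -> : r x = (r x `^ N) `^ N^-1.
    by rewrite -powRrM divff ?gt_eqF// powRr1// ltW.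
  apply: ge0_ler_powR => //; rewrite ?nnegrE ?invr_ge0 ?powR_ge0 ?(ltW N_gt0)//.
  exact: le_trans (powR_ge0 _ _) rI.
have [D [DE tD coverD]] := vitali_covering rR0.
have cD : countable D.
  (* Members of [D] with radius above [1 / (k + 1)] and centre in a fixed ball are finitely many by
     packing; these classes exhaust [D]. *)
  pose S k : set X := D `&` ([set x | k.+1%:R^-1 < r x] `&` ball x0 k%:R).
  have -> : D = \bigcup_k S k.
    apply/seteqP; split => [x Dx|x [k _ []//]].
    have /andP[rx0 _] := rR0 _ (DE _ Dx).
    pose k1 := Num.truncn (r x)^-1; pose k2 := (Num.truncn (mdist x0 x)).+1.
    exists (maxn k1 k2) => //; split => //; split => /=.
      rewrite invf_plt ?posrE//; apply: (lt_le_trans (truncnS_gt _)).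
      by rewrite ler_nat ltnS leq_maxl.
    rewrite ballEmdist/=; apply: (lt_le_trans (truncnS_gt _)).
    by rewrite ler_nat leq_maxr.
  apply: bigcup_countable => // k _; apply: finite_set_countable.
  apply: (@trivIset_lb_measure_finite _ _ _ m _ _ (fun x => ball x (r x))
    (ball x0 (k%:R + R0)) (c^-1 * k.+1%:R^-1 `^ N)).
  - exact: measurable_metric_ball.
  - by apply: (@ahlfors_ball_lty _ _ _ m N); exists c.
  - by rewrite mulr_gt0 ?invr_gt0// powR_gt0// invr_gt0.
  - by apply: sub_trivIset tD => x [].
  - by move=> *; exact: measurable_metric_ball.
  - move=> x [Dx [_ x0x]] y xy; have /andP[_ rx] := rR0 _ (DE _ Dx).
    by apply: (ball_triangle x0x); exact: le_ball xy.
  - move=> x [Dx [/= kr _]]; have /andP[rx0 _] := rR0 _ (DE _ Dx).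
    apply: le_trans (m_ball x rx0).1; rewrite lee_fin ler_pM2l ?invr_gt0//.
    by apply: ge0_ler_powR; rewrite ?nnegrE ?invr_ge0 ?(ltW N_gt0) ?(ltW rx0)// ltW.
rewrite -ge0_integralZl_EFin//; last 2 first.
- exact: meas_abs.
- exact: ltW.
apply: (@le_trans _ _ (m (\bigcup_(i in D) ball i (5 * r i)))).
  apply: le_measure; rewrite ?inE.
  - exact/borel_open_measurable/ahlfors_maximal_open.
  - by apply: bigcup_countable_measurable => // i _; exact: measurable_metric_ball.
  - move=> x Ex; have [y Dy xy] := coverD x Ex; exists y => //; apply: xy.
    by apply: ballxx; have /andP[] := rR0 _ Ex.
apply: (measure_bigcup_le_integral (B := fun i => ball i (r i))) => //.
- by apply: measurable_funeM; exact: meas_abs.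
- by move=> x; rewrite mule_ge0// lee_fin ltW.
move=> i Di; split; [exact: measurable_metric_ball|exact: measurable_metric_ball|].
have [ri0 lri] := Hr i (DE _ Di).
rewrite ge0_integralZl_EFin//; last 3 first.
- exact: measurable_metric_ball.
- exact: meas_abs.
- exact: ltW.
have r5 : 0 < 5 * r i by rewrite mulr_gt0.
apply: (le_trans (m_ball i r5).2).
apply: (@le_trans _ _ ((c * 5 `^ N / l)%:E * (l * r i `^ N)%:E)%E).
  rewrite -EFinM lee_fin powRM ?(ltW ri0)//.
  by rewrite le_eqVlt; apply/orP; left; apply/eqP; field; rewrite gt_eqF.
by apply: lee_wpmul2l; [rewrite lee_fin ltW|exact: ltW].
Qed.

(** Cut [g] at height [l / (2 * c)]. Since [m(B(x, r)) <= c * r^N], the low part contributes at most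
    [l / 2] to the maximal function, so the high part must exceed [l / 2], and the weak-type bound
    applies to it at that level. *)
Lemma ahlfors_maximal_weak_type_trunc g (l : R) : measurable_fun [set: X] g -> 0 < l ->
  (m [set x | l%:E < ahlfors_maximal g x] <=
    (2 * c * 5 `^ N / l)%:E *
      \int[m]_x (`|g x| * \1_[set y | l < 2 * c * `|g y|] x)%:E)%E.
Proof.
move=> mg l0; set A := [set y | l < 2 * c * `|g y|].
have mA : measurable A.
  rewrite (_ : A = (fun y => 2 * c * `|g y|) @^-1` `]l, +oo[%classic).
    have mF : measurable_fun [set: X] (fun y => 2 * c * `|g y|).
      by apply: measurable_funM => //; apply: measurableT_comp => //; exact: normr_measurable.
    by rewrite -[_ @^-1` _]setTI; exact: mF.
  by apply/seteqP; split => y; rewrite /A/= in_itv/= andbT.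
pose g1 y := g y * \1_A y.
have mg1 : measurable_fun [set: X] g1.
  by apply: measurable_funM => //; exact: measurable_indic.
have g1E y : `|(g1 y)%:E|%E = (`|g y| * \1_A y)%:E.
  by rewrite abse_EFin normrM [X in _ * X]ger0_norm.
have l2 : 0 < l / 2 by rewrite divr_gt0.
have := ahlfors_maximal_weak_type mg1 l2.
under [in X in (_ <= _ * X)%E -> _]eq_integral do rewrite g1E.
have -> : c * 5 `^ N / (l / 2) = 2 * c * 5 `^ N / l by field; rewrite gt_eqF.
apply: le_trans; apply: le_measure; rewrite ?inE.
- exact/borel_open_measurable/ahlfors_maximal_open.
- exact/borel_open_measurable/ahlfors_maximal_open.
move=> x /= /ereal_sup_gt[_ [r /= + <-]]; rewrite in_itv/= andbT => r0 lr.
have rN : 0 < r `^ N by exact: powR_gt0.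
have mb := measurable_metric_ball x r.
have lc : 0 <= l / (2 * c) by rewrite ltW// divr_gt0// mulr_gt0.
have le1 : (\int[m]_(y in ball x r) `|(g y)%:E| <=
    \int[m]_(y in ball x r) `|(g1 y)%:E| + (l / 2 * r `^ N)%:E)%E.
  apply: (@le_trans _ _ (\int[m]_(y in ball x r) (`|(g1 y)%:E| + (l / (2 * c))%:E))%E).
    apply: ge0_le_integral => //; first exact: meas_abs.
      by apply: emeasurable_funD => //; exact: meas_abs.
    move=> y _; rewrite g1E abse_EFin -EFinD lee_fin indicE.
    have [_|] := boolP (y \in A); first by rewrite mulr1 lerDl.
    rewrite notin_setE /A/= => /negP; rewrite -leNgt mulr0 add0r.
    by rewrite ler_pdivlMr ?mulr_gt0// mulrC.
  rewrite ge0_integralD//; last exact: meas_abs.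
  rewrite integral_cst// leeD2l//.
  apply: (le_trans (lee_wpmul2l _ (m_ball x r0).2)); first by rewrite lee_fin.
  rewrite -EFinM lee_fin le_eqVlt; apply/orP; left; apply/eqP; field.
  by rewrite gt_eqF.
have lt2 : (l%:E < ((r `^ N)^-1)%:E * \int[m]_(y in ball x r) `|(g1 y)%:E| + (l / 2)%:E)%E.
  apply: (lt_le_trans lr).
  apply: (le_trans (lee_wpmul2l _ le1)); first by rewrite lee_fin invr_ge0 ltW.
  rewrite muleDr//; last by rewrite ge0_adde_def// inE ?integral_ge0// lee_fin mulr_ge0 ?ltW.
  rewrite leeD2l// -EFinM lee_fin le_eqVlt; apply/orP; left; apply/eqP; field.
  by rewrite gt_eqF.
have lt3 : ((l / 2)%:E < ((r `^ N)^-1)%:E * \int[m]_(y in ball x r) `|(g1 y)%:E|)%E.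
  by move: lt2; rewrite -lteBlDr// -EFinB; congr (_%:E < _)%E; lra.
apply: (lt_le_trans lt3); apply: ereal_sup_ubound.
by exists r => //=; rewrite in_itv/= r0.
Qed.

Lemma poweR_layer_cake_le (p : R) (y : \bar R) : 1 < p -> (0 <= y)%E ->
  (y `^ p <= \int[@lebesgue_measure R]_(l in `]0%R, +oo[)
    (p * l `^ (p - 1) * (l%:E < y)%E%:R)%:E)%E.
Proof.
move=> p1 y0; have p0 : 0 < p by exact: lt_trans p1.
have mf (b : set R) : measurable_fun b (fun l => p * l `^ (p - 1)).
  apply: measurable_funTS.
  by apply: measurable_funM => //; exact: measurable_powR.
have mfe (b : set R) : measurable_fun b (fun l => (p * l `^ (p - 1))%:E).
  by apply/measurable_EFinP; exact: mf.
have mly (b : set R) : measurable_fun b (fun l : R => ((l%:E < y)%E%:R : R)).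
  apply: measurable_funTS; rewrite (_ : (fun _ => _) = \1_[set l | (l%:E < y)%E]); last first.
    by apply/funext => l; rewrite indicE mem_setE.
  apply: measurable_indic; rewrite -[X in measurable X]setTI.
  by apply: measurable_lte.
have real_le (a : R) : 0 < a -> (a%:E <= y)%E ->
    ((a `^ p)%:E <= \int[@lebesgue_measure R]_(l in `]0%R, +oo[)
      (p * l `^ (p - 1) * (l%:E < y)%E%:R)%:E)%E.
  move=> a0 ay; rewrite -integral_power0// -integral_itv_bndo_bndc//.
  apply: (@le_trans _ _ (\int[lebesgue_measure]_(l in `]0%R, a[)
      (p * l `^ (p - 1) * (l%:E < y)%E%:R)%:E)%E).
    rewrite le_eqVlt; apply/orP; left; apply/eqP; apply: eq_integral => l.
    rewrite inE/= in_itv/= => /andP[_ la].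
    by rewrite (lt_le_trans _ ay) ?lte_fin// mulr1.
  apply: ge0_subset_integral => //.
  - by apply/measurable_EFinP; apply: measurable_funM; [exact: mf|exact: mly].
  - by move=> l _; rewrite lee_fin mulr_ge0// mulr_ge0 ?powR_ge0// ltW.
  - by move=> l; rewrite /= !in_itv/= => /andP[->].
have ge0 : (0 <= \int[@lebesgue_measure R]_(l in `]0%R, +oo[)
    (p * l `^ (p - 1) * (l%:E < y)%E%:R)%:E)%E.
  by apply: integral_ge0 => l _; rewrite lee_fin mulr_ge0// mulr_ge0 ?powR_ge0// ltW.
case: y y0 real_le ge0 {mly} => [a| |//] a0 real_le ge0; last first.
  (* For [y = +oo], the choice [a = A^(1/p)] in [real_le] bounds the integral below by every
     [A > 0]. *)
  rewrite [leRHS](_ : _ = +oo%E) ?leey//; apply/eqyP => A A0.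
  have := @real_le (A `^ p^-1); rewrite powR_gt0// leey => /(_ isT isT).
  by rewrite -powRrM mulVf ?gt_eqF// powRr1// ltW.
rewrite poweR_EFin; move: a0; rewrite lee_fin le_eqVlt => /orP[/eqP a0E|a0].
  by rewrite -{1}a0E powR0// gt_eqF.
exact: real_le.
Qed.

(** Marcinkiewicz interpolation: insert the truncated weak-type bound into the layer-cake formula
    and exchange integrals. What remains is the integral of [l^(p - 2)] over
    [0 < l < 2 * c * |g x|], finite because [p > 1], which produces [p - 1] and [(2 * c)^(p - 1)] in
    [C]. *)
Lemma ahlfors_maximal_strong_type (p : R) : 1 < p ->
  exists2 C : R, 0 < C & forall g, measurable_fun [set: X] g ->
    (\int[m]_x ahlfors_maximal g x `^ p <= C%:E * \int[m]_x (`|g x| `^ p)%:E)%E.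
Proof.
move=> p1; have p0 : 0 < p by exact: lt_trans p1.
have pm1 : 0 < p - 1 by rewrite subr_gt0.
pose A := 2 * c * 5 `^ N.
have A0 : 0 < A by rewrite !mulr_gt0// powR_gt0.
have c2 : 0 < 2 * c by rewrite mulr_gt0.
pose C := A * p / (p - 1) * (2 * c) `^ (p - 1).
have C0 : 0 < C by rewrite mulr_gt0// ?powR_gt0// divr_gt0// mulr_gt0.
exists C => // g mg.
have mM := measurable_ahlfors_maximal mg.
pose L x l := (p * l `^ (p - 1) * (l%:E < ahlfors_maximal g x)%E%:R)%:E : \bar R.
(* [L2] is [p * l^(p - 1)] times the truncated integrand of the weak-type bound with its constant
   [A / l], hence the power [p - 2]. *)
pose L2 x l := (A * p * l `^ (p - 2) * `|g x| * (l < 2 * c * `|g x|)%R%:R)%:E : \bar R.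
have mpow (q : R) : measurable_fun [set: X * R] (fun w => w.2 `^ q).
  exact: (measurableT_comp (measurable_powR q) measurable_snd).
have mabs : measurable_fun [set: X * R] (fun w => `|g w.1|).
  apply: measurableT_comp; first exact: normr_measurable.
  exact: measurableT_comp.
have mL : measurable_fun [set: X * R] (fun w => L w.1 w.2).
  apply/measurable_EFinP; apply: measurable_funM; first exact: measurable_funM.
  rewrite (_ : (fun _ => _) = \1_[set w | (w.2%:E < ahlfors_maximal g w.1)%E]); last first.
    by apply/funext => w; rewrite indicE mem_setE.
  apply: measurable_indic; rewrite -[X in measurable X]setTI.
  apply: measurable_lte => //; first by apply/measurable_EFinP.
  exact: (measurableT_comp mM).
have mL2 : measurable_fun [set: X * R] (fun w => L2 w.1 w.2).
  apply/measurable_EFinP; apply: measurable_funM.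
    by apply: measurable_funM => //; exact: measurable_funM.
  rewrite (_ : (fun _ => _) = \1_[set w | (w.2%:E < (2 * c * `|g w.1|)%:E)%E]); last first.
    by apply/funext => w; rewrite indicE mem_setE.
  apply: measurable_indic; rewrite -[X in measurable X]setTI.
  apply: measurable_lte => //; first by apply/measurable_EFinP.
  by apply/measurable_EFinP; exact: measurable_funM.
have L0 x l : 0 < l -> (0 <= L x l)%E.
  by move=> l0; rewrite lee_fin mulr_ge0// mulr_ge0 ?powR_ge0// ltW.
have L20 x l : 0 < l -> (0 <= L2 x l)%E.
  by move=> l0; rewrite lee_fin !mulr_ge0 ?powR_ge0// ltW.
apply: (@le_trans _ _ (\int[m]_x \int[lebesgue_measure]_(l in `]0%R, +oo[) L x l)%E).
  apply: ge0_le_integral => //.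
  - by move=> x _; exact: poweR_ge0.
  - exact: (measurableT_comp (measurable_poweR p)).
  - exact: measurable_integral_positive.
  - by move=> x _; apply: poweR_layer_cake_le => //; exact: ahlfors_maximal_ge0.
rewrite tonelli_positive//.
apply: (@le_trans _ _ (\int[lebesgue_measure]_(l in `]0%R, +oo[) \int[m]_x L2 x l)%E).
  apply: ge0_le_integral => //.
  - by move=> l; rewrite /= in_itv/= andbT => l0; apply: integral_ge0 => x _; exact: L0.
  - exact: measurable_positive_integral.
  - exact: measurable_positive_integral.
  move=> l; rewrite /= in_itv/= andbT => l0.
  have mE : measurable [set x | (l%:E < ahlfors_maximal g x)%E].
    exact/borel_open_measurable/ahlfors_maximal_open.
  have plA : (0 <= p * l `^ (p - 1))%R by rewrite mulr_ge0 ?powR_ge0// ltW.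
  have -> : (\int[m]_x L x l =
      (p * l `^ (p - 1))%:E * m [set x | (l%:E < ahlfors_maximal g x)%E])%E.
    transitivity (\int[m]_x ((p * l `^ (p - 1))%:E *
        (\1_[set x | (l%:E < ahlfors_maximal g x)%E] x)%:E))%E.
      by apply: eq_integral => x _; rewrite /L EFinM indicE mem_setE.
    rewrite ge0_integralZl_EFin//; last exact/measurable_EFinP/measurable_indic.
    by rewrite integral_indic// setIT.
  apply: (le_trans (lee_wpmul2l _ (ahlfors_maximal_weak_type_trunc mg l0))).
    by rewrite lee_fin.
  have mA : measurable [set y | l < 2 * c * `|g y|].
    have mF : measurable_fun [set: X] (fun y => 2 * c * `|g y|).
      by apply: measurable_funM => //; apply: measurableT_comp => //; exact: normr_measurable.
    rewrite (_ : [set y | _] = (fun y => 2 * c * `|g y|) @^-1` `]l, +oo[%classic).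
      by rewrite -[_ @^-1` _]setTI; exact: mF.
    by apply/seteqP; split => y; rewrite /= in_itv/= andbT.
  rewrite muleA -EFinM -ge0_integralZl_EFin//; last 2 first.
  - apply/measurable_EFinP; apply: measurable_funM; last exact: measurable_indic.
    by apply: measurableT_comp => //; exact: normr_measurable.
  - by rewrite mulr_ge0// ltW// divr_gt0.
  rewrite le_eqVlt; apply/orP; left; apply/eqP; apply: eq_integral => x _.
  rewrite /L2 -EFinM indicE mem_setE; congr EFin.
  have -> : l `^ (p - 2) = l `^ (p - 1) / l.
    rewrite -[X in _ / X](powRr1 (ltW l0)) -powRB; last by apply/implyP => _; rewrite gt_eqF.
    by congr (_ `^ _); ring.
  by rewrite /A; field; rewrite gt_eqF.
rewrite -tonelli_positive// -ge0_integralZl_EFin//; last 2 first.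
- apply/measurable_EFinP; apply: (measurableT_comp (measurable_powR p)).
  by apply: measurableT_comp => //; exact: normr_measurable.
- exact: ltW.
rewrite le_eqVlt; apply/orP; left; apply/eqP; apply: eq_integral => x _.
have [gx0|gx0] := eqVneq (g x) 0.
  rewrite gx0 normr0 powR0 ?gt_eqF// mule0; apply: integral0_eq => l _.
  by rewrite /L2 gx0 normr0 mulr0 mul0r.
have ax : 0 < 2 * c * `|g x| by rewrite mulr_gt0// normr_gt0.
have kx : 0 <= A * p / (p - 1) * `|g x|.
  by rewrite mulr_ge0// ltW// divr_gt0// mulr_gt0.
transitivity ((A * p / (p - 1) * `|g x|)%:E *
    \int[lebesgue_measure]_(l in `]0%R, (2 * c * `|g x|)%R[) ((p - 1) * l `^ (p - 1 - 1))%:E)%E.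
  rewrite -ge0_integralZl_EFin//; last 2 first.
  - by move=> l _; rewrite lee_fin mulr_ge0 ?powR_ge0// ltW.
  - apply/measurable_EFinP/measurable_funTS.
    by apply: measurable_funM => //; exact: measurable_powR.
  rewrite [LHS]integral_mkcond [RHS]integral_mkcond; congr (integral _ _ _); apply/funext => l.
  rewrite !patchE !mem_setE !in_itv/= andbT.
  have [l0|//] := ltP 0 l; case: ifPn => /= [la|/negbTE la]; rewrite /L2 la ?mulr0//.
  rewrite mulr1 -EFinM; congr EFin; have -> : p - 1 - 1 = p - 2 by ring.
  by field; rewrite gt_eqF.
rewrite integral_itv_bndo_bndc//; last first.
  apply/measurable_EFinP/measurable_funTS.
  by apply: measurable_funM => //; exact: measurable_powR.
rewrite integral_power0// -!EFinM; congr EFin.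
rewrite powRM ?(ltW c2)// -(@mulr_powRB1 _ (`|g x|) p)// /C.
by rewrite mulrACA.
Qed.

End maximal.

(** * The maximal theorem for norms, including the exponent [+oo] *)

Section maximal_norm.
Context {R : realType} {d : measure_display} {X : borelMetricType d R}.
Variables (m : {sigma_finite_measure set X -> \bar R}) (N c : R).
Hypothesis N_gt0 : 0 < N.
Hypothesis c_gt0 : 0 < c.
Hypothesis m_ball : forall (x : X) (r : R), 0 < r ->
  ((c^-1 * r `^ N)%:E <= m (ball x r))%E /\ (m (ball x r) <= (c * r `^ N)%:E)%E.
Hypothesis m_infty : m [set: X] = +oo%E.

(** Finiteness almost everywhere ensures that [fine] alters the maximal function on a null set at
    most. For [p = +oo] the bound holds at every point, with the constant of
    [m(B(x, r)) <= c * r^N]; for finite [p] finiteness follows from that of the integral of the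
    [p]-th power. *)
Lemma ahlfors_maximal_Lnorm (p : \bar R) : (1 < p)%E ->
  exists2 C : R, 0 < C & forall g, measurable_fun [set: X] g ->
    ('N[m]_p[EFin \o g] < +oo)%E ->
    (\forall x \ae m, (ahlfors_maximal m N g x < +oo)%E) /\
    ('N[m]_p[EFin \o (fine \o ahlfors_maximal m N g)] <=
      C%:E * 'N[m]_p[EFin \o g])%E.
Proof.
case: p => [p| |//]; last first.
  move=> _; exists c => // g mg gfin.
  (* The norm at [+oo] is the essential supremum when the space has positive measure, and 0
     otherwise; [m_infty] selects the first case. *)
  have g_le : \forall y \ae m, (`|(g y)%:E| <= 'N[m]_+oo[EFin \o g])%E.
    have := ess_sup_ge m (abse \o (EFin \o g)).
    by rewrite unlock /= m_infty ltry.
  set S := 'N[m]_+oo[EFin \o g]%E in g_le gfin *.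
  have S0 : (0 <= S)%E by exact: Lnorm_ge0.
  have Sfin : S \is a fin_num by rewrite ge0_fin_numE.
  have M_le x : (ahlfors_maximal m N g x <= c%:E * S)%E.
    apply: ge_ereal_sup => _ [r /= + <-]; rewrite in_itv/= andbT => r0.
    have rN : 0 < r `^ N by exact: powR_gt0.
    have mb := measurable_metric_ball x r.
    rewrite lee_pdivrMl//.
    apply: (@le_trans _ _ (\int[m]_(y in ball x r) S)%E).
      apply: ae_ge0_le_integral => //.
      - by apply: measurable_funTS; apply/measurable_EFinP; apply: measurableT_comp.
      - by apply: filterS g_le => y.
    rewrite integral_cst// muleA muleC -EFinM.
    by apply: lee_wpmul2r => //; rewrite mulrC; exact: (m_ball x r0).2.
  have M0 x := ahlfors_maximal_ge0 m N g x.
  have Mfin x : ahlfors_maximal m N g x \is a fin_num.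
    by rewrite ge0_fin_numE// (le_lt_trans (M_le x))// -(fineK Sfin) -EFinM ltry.
  split; first by apply: aeW => x; rewrite -ge0_fin_numE.
  rewrite unlock/= m_infty ltry; apply/ess_supP; apply: aeW => x /=.
  by rewrite ger0_norm ?fine_ge0// (fineK (Mfin x)).
rewrite lte_fin => p1; have p0 : 0 < p by exact: lt_trans p1.
have [C C0 HC] := ahlfors_maximal_strong_type N_gt0 c_gt0 m_ball p1.
exists (C `^ p^-1); first exact: powR_gt0.
move=> g mg gfin.
have mM : measurable_fun [set: X] (ahlfors_maximal m N g).
  exact: measurable_ahlfors_maximal.
have gE : (\int[m]_x (`|g x| `^ p)%:E = 'N[m]_p%:E[EFin \o g] `^ p)%E.
  by rewrite poweR_Lnorm ?gt_eqF.
have ifin : (\int[m]_x (ahlfors_maximal m N g x `^ p) < +oo)%E.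
  apply: (le_lt_trans (HC g mg)); rewrite gE; apply: lte_mul_pinfty => //.
    by rewrite lee_fin ltW.
  exact: poweR_lty.
have M0 x := ahlfors_maximal_ge0 m N g x.
have mMp : measurable_fun [set: X] (fun x => (ahlfors_maximal m N g x `^ p)%E).
  exact: (measurableT_comp (measurable_poweR p)).
split.
  have : m.-integrable [set: X] (fun x => (ahlfors_maximal m N g x `^ p)%E).
    apply/integrableP; split => //.
    by under eq_integral => x _ do rewrite gee0_abs ?poweR_ge0//.
  move=> /integrable_ae => /(_ measurableT); apply: filterS => x /(_ I).
  case: (ahlfors_maximal m N g x) => [r _| |//]; first by rewrite ltry.
  by rewrite poweRyr// gt_eqF.
rewrite unlock /=.
have leM : (\int[m]_x `|(fine (ahlfors_maximal m N g x))%:E| `^ p <=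
    C%:E * \int[m]_x `|(g x)%:E| `^ p)%E.
  apply: le_trans (HC g mg); apply: ge0_le_integral => //.
  - by move=> x _; exact: poweR_ge0.
  - apply: (measurableT_comp (measurable_poweR p)); apply: measurableT_comp => //.
    apply/measurable_EFinP; apply: measurableT_comp mM.
    exact: fine_measurable.
  - move=> x _; apply: gt0_ler_poweR; rewrite ?in_itv/= ?leey ?andbT ?lee_fin ?(ltW p0)//.
    have := M0 x; case: (ahlfors_maximal m N g x) => //= [r|_].
      by rewrite lee_fin => r0; rewrite ger0_norm.
    by rewrite normr0 leey.
apply: (@le_trans _ _ ((C%:E * \int[m]_x `|(g x)%:E| `^ p) `^ p^-1)%E).
  have i0 (f : X -> R) : (0 <= \int[m]_x (`|f x| `^ p)%:E)%E.
    by apply: integral_ge0 => x _; rewrite lee_fin powR_ge0.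
  apply: gt0_ler_poweR; rewrite ?in_itv/= ?leey ?andbT ?invr_ge0 ?(ltW p0)//.
  by apply: mule_ge0; [rewrite lee_fin ltW|exact: i0].
rewrite poweRM ?poweR_EFin//; first by rewrite lee_fin ltW.
by apply: integral_ge0 => x _; exact: poweR_ge0.
Qed.

End maximal_norm.

(** * The potential *)

Section positive_integral.
Context {R : realType}.
Notation mu := (@lebesgue_measure R).

Lemma eq_integral_positive (f g : R -> \bar R) :
  (forall t, 0 < t -> f t = g t) ->
  (\int[mu]_(t in `]0%R, +oo[) f t = \int[mu]_(t in `]0%R, +oo[) g t)%E.
Proof.
move=> fg; apply: eq_integral => t; rewrite inE/= in_itv/= andbT; exact: fg.
Qed.

Lemma le_integral_positive (f g : R -> \bar R) :
  measurable_fun (`]0, +oo[%classic : set R) f ->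
  measurable_fun (`]0, +oo[%classic : set R) g ->
  (forall t, 0 < t -> (0 <= f t)%E) -> (forall t, 0 < t -> (f t <= g t)%E) ->
  (\int[mu]_(t in `]0%R, +oo[) f t <= \int[mu]_(t in `]0%R, +oo[) g t)%E.
Proof.
move=> mf mg f0 fg; apply: ge0_le_integral => // t; rewrite /= in_itv/= andbT.
  exact: f0.
exact: fg.
Qed.

End positive_integral.

(** * The weight in time *)

Section weight.
Context {R : realType}.
Variable alpha : R.
Hypothesis alpha_gt0 : 0 < alpha.

Definition weight (t : R) : R := alpha * (t `^ alpha / (1 + t `^ alpha) ^+ 2 / t).

Lemma measurable_weight : measurable_fun [set: R] weight.
Proof.
have mp : measurable_fun [set: R] (fun t => t `^ alpha) by exact: measurable_powR.
apply: measurable_funM => //; apply: measurable_funM; last exact: measurable_fun_inv.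
apply: measurable_funM => //; apply: measurable_fun_inv.
by apply: measurable_funX; exact: measurable_funD.
Qed.

Lemma weight_ge0 t : 0 < t -> 0 <= weight t.
Proof.
move=> t0; rewrite /weight mulr_ge0 ?(ltW alpha_gt0)//.
by rewrite !mulr_ge0 ?powR_ge0// invr_ge0 ?sqr_ge0// ltW.
Qed.

Lemma weight_le0 t : 0 < t -> weight t <= alpha * t `^ (alpha - 1).
Proof.
move=> t0; have ta := powR_gt0 alpha t0.
rewrite /weight ler_pM2l// powRB; last by apply/implyP => _; rewrite gt_eqF.
rewrite powRr1 ?(ltW t0)// ler_pM2r ?invr_gt0// ler_pdivrMr; last first.
  by rewrite exprn_gt0// ltr_wpDl// ltW.
by rewrite ler_peMr ?(ltW ta)// expr2; nra.
Qed.

Lemma weight_le_infty t : 0 < t -> weight t <= alpha * t `^ (- alpha - 1).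
Proof.
move=> t0; have ta := powR_gt0 alpha t0.
rewrite /weight ler_pM2l// powRB; last by apply/implyP => _; rewrite gt_eqF.
rewrite powRr1 ?(ltW t0)// ler_pM2r ?invr_gt0// powRN ler_pdivrMr; last first.
  by rewrite exprn_gt0// ltr_wpDl// ltW.
by rewrite mulrC ler_pdivlMr// expr2; nra.
Qed.

(** With [u = t^alpha], the bounds [(1 + u)^2 >= 1] up to time 1 and [(1 + u)^2 >= u^2] afterwards
    contribute [k] each. *)
Lemma integral_weight_le (k : R) : 0 <= k ->
  (\int[@lebesgue_measure R]_(t in `]0%R, +oo[) (weight t * k)%:E <= (2 * k)%:E)%E.
Proof.
move=> k0; rewrite (_ : 2 * k = k * 1 `^ alpha + k * 1 `^ (- alpha)); last first.
  by rewrite !powR1; ring.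
apply: integral_two_powers_le => //.
- apply/measurable_EFinP/measurable_funTS; apply: measurable_funM => //.
  exact: measurable_weight.
- by move=> t t0; rewrite lee_fin mulr_ge0// weight_ge0.
- by move=> t t0 _; rewrite lee_fin mulrC ler_wpM2l// weight_le0.
- move=> t t1; rewrite lee_fin mulrC ler_wpM2l// weight_le_infty//.
  exact: lt_trans t1.
Qed.

Lemma integral_weightE (k : R -> R) : measurable_fun [set: R] k ->
  (forall t, 0 < t -> 0 <= k t) ->
  (alpha%:E * \int[@lebesgue_measure R]_(t in `]0%R, +oo[)
     (t `^ alpha / (1 + t `^ alpha) ^+ 2 * k t / t)%:E =
   \int[@lebesgue_measure R]_(t in `]0%R, +oo[) (weight t * k t)%:E)%E.
Proof.
move=> mk k0; have mp : measurable_fun [set: R] (fun t => t `^ alpha).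
  exact: measurable_powR.
rewrite -ge0_integralZl_EFin//; last 3 first.
- move=> t; rewrite /= in_itv/= andbT => t0; rewrite lee_fin.
  apply: divr_ge0; last exact: ltW.
  by apply: mulr_ge0; [rewrite divr_ge0 ?powR_ge0 ?sqr_ge0|exact: k0].
- apply/measurable_EFinP/measurable_funTS; apply: measurable_funM; last first.
    exact: measurable_fun_inv.
  apply: measurable_funM => //; apply: measurable_funM => //.
  by apply: measurable_fun_inv; apply: measurable_funX; exact: measurable_funD.
- exact: ltW.
by apply: eq_integral_positive => t t0; rewrite -EFinM /weight; congr EFin; ring.
Qed.

End weight.

Section potential.
Context {R : realType} {d : measure_display} {X : borelMetricType d R}.
Variables (m : {sigma_finite_measure set X -> \bar R}) (N c K alpha beta : R).
Variable s : X -> X -> R -> R.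
Hypothesis c_gt0 : 0 < c.
Hypothesis m_ball : forall (x : X) (r : R), 0 < r ->
  ((c^-1 * r `^ N)%:E <= m (ball x r))%E /\ (m (ball x r) <= (c * r `^ N)%:E)%E.
Hypothesis K_gt0 : 0 < K.
Hypothesis s_ge0 : forall x z t, 0 < t -> 0 <= s x z t.
Hypothesis s_bound : forall x z t, 0 < t -> s x z t <= K / t `^ N * \1_(ball x (4 * t)) z.
Hypothesis s_lipschitz : forall x y z t, 0 < t ->
  `|s x z t - s y z t| <= K * (mdist x y / t) / t `^ N.
Hypothesis s_mass : forall x t, 0 < t -> (\int[m]_z (s x z t)%:E = 1)%E.
Hypothesis s_meas : measurable_fun [set: (X * X) * R] (fun p => s p.1.1 p.1.2 p.2).
Hypothesis alpha_gt0 : 0 < alpha.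
Hypothesis beta_gt0 : 0 < beta.
Hypothesis alpha_beta_lt1 : alpha + beta < 1.
Hypothesis m_infty : m [set: X] = +oo%E.
Notation mu := (@lebesgue_measure R).
Notation V := (weight alpha).

Definition kern (x z : X) : \bar R := (\int[mu]_(t in `]0%R, +oo[) (V t * s x z t)%:E)%E.

Definition potential_defined (f : X -> R) (x : X) : Prop :=
  m.-integrable [set: X] (fun z => ((f z)%:E * kern x z)%E).

Definition potential (f : X -> R) (x : X) : R :=
  fine (\int[m]_z ((f z)%:E * kern x z))%E.

Let Vs_ge0 x z t : 0 < t -> (0 <= (V t * s x z t)%:E)%E.
Proof. by move=> t0; rewrite lee_fin mulr_ge0 ?weight_ge0 ?s_ge0. Qed.

Let kern_ge0 x z : (0 <= kern x z)%E.
Proof. by apply: integral_ge0 => t; rewrite /= in_itv/= andbT; exact: Vs_ge0. Qed.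

Let measurable_kern : measurable_fun [set: X * X] (fun p => kern p.1 p.2).
Proof.
apply: (@measurable_integral_positive _ (X * X)%type R
  (fun p t => (V t * s p.1 p.2 t)%:E)) => [|p t]; last exact: Vs_ge0.
apply/measurable_EFinP; apply: measurable_funM => //.
exact: (measurableT_comp (measurable_weight alpha) measurable_snd).
Qed.

Let measurable_kern1 x : measurable_fun [set: X] (kern x).
Proof. by apply: (measurableT_comp measurable_kern (g := pair x)). Qed.

Let s_meas_zt x : measurable_fun [set: X * R] (fun p => s x p.1 p.2).
Proof.
have H : measurable_fun [set: X * R] (fun p => ((x, p.1), p.2)).
  by apply: measurable_fun_pair => //; exact: measurable_fun_pair.
exact: (measurableT_comp s_meas H).
Qed.

Lemma measurable_potential_integrand (f : X -> R) x : measurable_fun [set: X] f ->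
  measurable_fun [set: X] (fun z => ((f z)%:E * kern x z)%E).
Proof. by move=> mf; apply: emeasurable_funM => //; exact/measurable_EFinP. Qed.

Lemma potential_ge0_tonelli (F : X -> R) x : measurable_fun [set: X] F ->
  (forall z, 0 <= F z) ->
  (\int[m]_z ((F z)%:E * kern x z) =
   \int[mu]_(t in `]0%R, +oo[) ((V t)%:E * \int[m]_z (s x z t * F z)%:E))%E.
Proof.
move=> mF F0.
have mH : measurable_fun [set: X * R] (fun p => (F p.1 * (V p.2 * s x p.1 p.2))%:E).
  apply/measurable_EFinP; apply: measurable_funM; first exact: measurableT_comp.
  apply: measurable_funM => //.
  exact: (measurableT_comp (measurable_weight alpha) measurable_snd).
transitivity (\int[m]_z \int[mu]_(t in `]0%R, +oo[) (F z * (V t * s x z t))%:E)%E.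
  apply: eq_integral => z _; rewrite -ge0_integralZl_EFin//.
  - by move=> t; rewrite /= in_itv/= andbT; exact: Vs_ge0.
  - apply/measurable_EFinP/measurable_funTS; apply: measurable_funM.
      exact: measurable_weight.
    by apply: (measurableT_comp (s_meas_zt x) (g := pair z)).
rewrite (@tonelli_positive _ _ _ m (fun z t => (F z * (V t * s x z t))%:E) mH)//; last first.
  by move=> z t t0; rewrite lee_fin; apply: mulr_ge0 => //; apply: mulr_ge0; [exact: weight_ge0|exact: s_ge0].
apply: eq_integral_positive => t t0.
rewrite -ge0_integralZl_EFin//.
- by apply: eq_integral => z _; rewrite -EFinM; congr EFin; ring.
- by move=> z _; rewrite lee_fin mulr_ge0 ?s_ge0.
- apply/measurable_EFinP; apply: measurable_funM => //.
  by apply: (measurableT_comp (s_meas_zt x) (g := fun z => (z, t))).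
- exact: weight_ge0.
Qed.

(** Every time slice is at most [K * 4^N * G], and the weight has integral at most 2. With [G] the
    maximal function of [f] this gives both the existence of [J f] and its size. *)
Lemma potential_bound (f : X -> R) x G : measurable_fun [set: X] f ->
  ball_growth m N f x G ->
  (\int[m]_z `|(f z)%:E * kern x z| <= (2 * (K * 4 `^ N * G))%:E)%E.
Proof.
move=> mf fG; have mfa : measurable_fun [set: X] (fun z => `|f z|).
  by apply: measurableT_comp => //; exact: normr_measurable.
have k0 : 0 <= K * 4 `^ N * G.
  by rewrite !mulr_ge0 ?powR_ge0 ?(ltW K_gt0)//; exact: ball_growth_ge0 fG.
under eq_integral => z _ do rewrite abseM (gee0_abs (kern_ge0 x z)) abse_EFin.
rewrite potential_ge0_tonelli//.
apply: le_trans (integral_weight_le alpha_gt0 k0).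
apply: le_integral_positive.
- apply: emeasurable_funM.
    by apply/measurable_EFinP/measurable_funTS; exact: measurable_weight.
  apply: (@measurable_positive_integral _ _ _ m (fun z t => (s x z t * `|f z|)%:E)).
    apply/measurable_EFinP; apply: measurable_funM => //.
    exact: (measurableT_comp mfa measurable_fst).
  by move=> z t t0; rewrite lee_fin mulr_ge0 ?s_ge0.
- apply/measurable_EFinP/measurable_funTS; apply: measurable_funM => //.
  exact: measurable_weight.
- move=> t t0; apply: mule_ge0; first by rewrite lee_fin weight_ge0.
  by apply: integral_ge0 => z _; rewrite lee_fin mulr_ge0 ?s_ge0.
move=> t t0; rewrite [leRHS]EFinM.
apply: lee_wpmul2l; first by rewrite lee_fin weight_ge0.
have := smooth_growth K_gt0 s_ge0 s_bound s_meas t0 mf fG.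
apply: le_trans; rewrite le_eqVlt; apply/orP; left; apply/eqP.
by apply: eq_integral => z _; rewrite abse_EFin normrM (ger0_norm (s_ge0 _ _ t0)).
Qed.

Let measurable_smooth_pos (F : X -> R) x : measurable_fun [set: X] F ->
  (forall z, 0 <= F z) -> measurable_fun (`]0, +oo[%classic : set R)
    (fun t => (V t)%:E * \int[m]_z (s x z t * F z)%:E)%E.
Proof.
move=> mF F0; apply: emeasurable_funM.
  by apply/measurable_EFinP/measurable_funTS; exact: measurable_weight.
apply: (@measurable_positive_integral _ _ _ m (fun z t => (s x z t * F z)%:E)).
  apply/measurable_EFinP; apply: measurable_funM => //.
  exact: (measurableT_comp mF measurable_fst).
by move=> z t t0; rewrite lee_fin mulr_ge0 ?s_ge0.
Qed.

Let V_int_ge0 (F : X -> R) x t : (forall z, 0 <= F z) -> 0 < t ->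
  (0 <= (V t)%:E * \int[m]_z (s x z t * F z)%:E)%E.
Proof.
move=> F0 t0; apply: mule_ge0; first by rewrite lee_fin weight_ge0.
by apply: integral_ge0 => z _; rewrite lee_fin mulr_ge0 ?s_ge0.
Qed.

(** Fubini for signed [f]: absolute convergence passes to the positive and negative parts, Tonelli
    applies to each, and the results are subtracted. Integrability of each time slice identifies the
    difference with the real number [smooth m s f t x] at every [t > 0]. *)
Lemma potential_integrableE (f : X -> R) x : measurable_fun [set: X] f ->
  (forall t, 0 < t -> m.-integrable [set: X] (fun z => (s x z t * f z)%:E)) ->
  potential_defined f x ->
  mu.-integrable `]0, +oo[ (fun t => (V t * smooth m s f t x)%:E) /\
  (\int[mu]_(t in `]0%R, +oo[) (V t * smooth m s f t x)%:E = (potential f x)%:E)%E.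
Proof.
move=> mf isf df.
have mfp : measurable_fun [set: X] (f^\+)%R by exact: measurable_funrpos.
have mfn : measurable_fun [set: X] (f^\-)%R by exact: measurable_funrneg.
have fp0 z : 0 <= (f^\+)%R z by exact: funrpos_ge0.
have fn0 z : 0 <= (f^\-)%R z by exact: funrneg_ge0.
have fE z : f z = (f^\+)%R z - (f^\-)%R z by rewrite -[in LHS](funrposBneg f).
pose P (F : X -> R) t := ((V t)%:E * \int[m]_z (s x z t * F z)%:E)%E.
have le_abs (F : X -> R) z : `|F z| <= `|f z| -> (`|(F z)%:E * kern x z| <= `|(f z)%:E * kern x z|)%E.
  by move=> Ff; rewrite !abseM; apply: lee_wpmul2r => //; rewrite !abse_EFin lee_fin.
have fp_le z : `|(f^\+)%R z| <= `|f z|.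
  by rewrite ger0_norm// /funrpos maxEle; case: ifPn => // _; exact: ler_norm.
have fn_le z : `|(f^\-)%R z| <= `|f z|.
  by rewrite ger0_norm// /funrneg maxEle; case: ifPn => // _; rewrite -normrN ler_norm.
have dpart (F : X -> R) : measurable_fun [set: X] F -> (forall z, 0 <= F z) ->
    (forall z, `|F z| <= `|f z|) ->
    m.-integrable [set: X] (fun z => ((F z)%:E * kern x z)%E) /\
    mu.-integrable `]0, +oo[ (P F).
  move=> mF F0 Ff.
  have iF : m.-integrable [set: X] (fun z => ((F z)%:E * kern x z)%E).
    apply: (le_integrable measurableT _ _ df) => [|z _]; last exact: le_abs.
    by apply: emeasurable_funM => //; exact/measurable_EFinP.
  split=> //; apply/integrableP; split; first exact: measurable_smooth_pos.
  have : (\int[m]_z ((F z)%:E * kern x z))%E \is a fin_num.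
    by apply: integrable_fin_num.
  rewrite potential_ge0_tonelli//.
  rewrite ge0_fin_numE; last first.
    by apply: integral_ge0 => t; rewrite /= in_itv/= andbT; exact: V_int_ge0.
  apply: le_lt_trans; rewrite le_eqVlt; apply/orP; left; apply/eqP.
  by apply: eq_integral_positive => t t0; rewrite gee0_abs//; exact: V_int_ge0.
have [idp ipp] := dpart _ mfp fp0 fp_le.
have [idn ipn] := dpart _ mfn fn0 fn_le.
have sint (F : X -> R) t : measurable_fun [set: X] F -> (forall z, `|F z| <= `|f z|) -> 0 < t ->
    m.-integrable [set: X] (fun z => (s x z t * F z)%:E).
  move=> mF Ff t0; apply: (le_integrable measurableT _ _ (isf t t0)) => [|z _].
    apply/measurable_EFinP; apply: measurable_funM => //.
    by apply: (measurableT_comp (s_meas_zt x) (g := fun z => (z, t))).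
  by rewrite !abse_EFin lee_fin !normrM ler_wpM2l.
have PE t : 0 < t -> (P (f^\+)%R t - P (f^\-)%R t = (V t * smooth m s f t x)%:E)%E.
  move=> t0; have ip := sint _ _ mfp fp_le t0; have ine := sint _ _ mfn fn_le t0.
  rewrite /P -muleBr//; last first.
    by rewrite fin_num_adde_defr//; apply: integrable_fin_num.
  rewrite -integralB// [RHS]EFinM; congr (_ * _)%E.
  rewrite /smooth /Rintegral fineK; last first.
    by apply: integrable_fin_num => //; exact: isf.
  apply: eq_integral => z _; rewrite -EFinB -mulrBr; congr (EFin (_ * _)).
  exact/esym/fE.
have iB : mu.-integrable `]0, +oo[ (fun t => P (f^\+)%R t - P (f^\-)%R t)%E.
  exact: integrableB.
split.
  apply: eq_integrable iB => // t; rewrite inE/= in_itv/= andbT => t0.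
  exact: PE.
transitivity (\int[mu]_(t in `]0%R, +oo[) (P (f^\+)%R t - P (f^\-)%R t))%E.
  by apply: eq_integral_positive => t t0; rewrite PE.
rewrite integralB// -!potential_ge0_tonelli// -integralB//.
rewrite /potential fineK; last exact: integrable_fin_num.
apply: eq_integral => z _; rewrite /funrpos /funrneg; have [z0|/ltW z0] := leP 0 (f z).
  by rewrite (max_idPr _) ?oppr_le0// mul0e sube0.
rewrite (max_idPl _) ?oppr_ge0// mul0e sub0e.
by rewrite EFinN mulNe oppeK.
Qed.

(** The integral is a difference of two Tonelli functions, measurable even where one or both are
    infinite, and [fine] is measurable. *)
Lemma measurable_potential (f : X -> R) : measurable_fun [set: X] f ->
  measurable_fun [set: X] (potential f).
Proof.
move=> mf; pose phi (p : X * X) := ((f p.2)%:E * kern p.1 p.2)%E.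
have mphi : measurable_fun [set: X * X] phi.
  apply: emeasurable_funM => //; apply/measurable_EFinP.
  exact: (measurableT_comp mf measurable_snd).
apply: (@measurableT_comp _ _ _ _ _ _ fine); first exact: fine_measurable.
rewrite (_ : (fun x => _) = fun x => (\int[m]_z (phi^\+)%E (x, z) - \int[m]_z (phi^\-)%E (x, z))%E).
  apply: emeasurable_funB.
    apply: (@measurable_fun_fubini_tonelli_F _ _ _ _ _ m (phi^\+)%E) => //.
    exact: measurable_funepos.
  apply: (@measurable_fun_fubini_tonelli_F _ _ _ _ _ m (phi^\-)%E) => //.
  exact: measurable_funeneg.
apply/funext => x; rewrite integralE; congr (_ - _)%E; apply: eq_integral => z _.
  by rewrite !funeposE.
by rewrite !funenegE.
Qed.

Lemma potential_ae_eq (f1 f2 : X -> R) x :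
  measurable_fun [set: X] f1 -> measurable_fun [set: X] f2 ->
  (\forall z \ae m, f1 z = f2 z) -> potential f1 x = potential f2 x.
Proof.
move=> mf1 mf2 f12; rewrite /potential; congr fine; apply: ae_eq_integral => //.
- by apply: emeasurable_funM => //; exact/measurable_EFinP.
- by apply: emeasurable_funM => //; exact/measurable_EFinP.
- by apply: filterS f12 => z /= ->.
Qed.

Lemma potential_linear (a : R) (f1 f2 : X -> R) x :
  measurable_fun [set: X] f1 -> measurable_fun [set: X] f2 ->
  potential_defined f1 x -> potential_defined f2 x ->
  potential (fun z => a * f1 z + f2 z) x = a * potential f1 x + potential f2 x.
Proof.
move=> mf1 mf2 d1 d2; rewrite /potential.
have d1' : m.-integrable [set: X] (fun z => (a%:E * ((f1 z)%:E * kern x z))%E).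
  exact: integrableZl.
have i1 : (\int[m]_z ((f1 z)%:E * kern x z))%E \is a fin_num.
  exact: integrable_fin_num.
have i2 : (\int[m]_z ((f2 z)%:E * kern x z))%E \is a fin_num.
  exact: integrable_fin_num.
transitivity (fine (\int[m]_z (a%:E * ((f1 z)%:E * kern x z) + (f2 z)%:E * kern x z))%E).
  congr fine; apply: ae_eq_integral => //.
  - apply: emeasurable_funM => //; apply/measurable_EFinP.
    by apply: measurable_funD => //; exact: measurable_funM.
  - by apply: emeasurable_funD; [exact: measurable_int d1'|exact: measurable_int d2].
  - (* Off a null set [f1 z = f2 z = 0] wherever the kernel is infinite. *)
    have := integrable_ae measurableT d2; have := integrable_ae measurableT d1.
    apply: filterS2 => z /(_ I) + /(_ I) + _; have := kern_ge0 x z.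
    case: (kern x z) => [k _ _ _| _|//]; first by rewrite -!EFinM -EFinD mulrDl mulrA.
    have zero (u : R) : (u%:E * +oo)%E \is a fin_num -> u = 0.
      have [u0|u0|->//] := ltgtP u 0; first by rewrite lt0_muley ?lte_fin.
      by rewrite gt0_muley ?lte_fin.
    by move=> /zero -> /zero ->; rewrite mulr0 addr0 mul0e mule0 adde0.
rewrite integralD// integralZl// fineD//; first by rewrite fineM.
by rewrite fin_numM.
Qed.

(** The estimate is pointwise and holds at points of [E] as well, since [f] and [g] enter through
    integrals only. *)
Lemma potential_diff_le : exists2 C : R, 0 < C &
  forall (f g : X -> R) (E : set X), measurable_fun [set: X] f ->
    measurable_fun [set: X] g -> (forall x, 0 <= g x) -> m.-negligible E ->
    (forall x y, ~ E x -> ~ E y ->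
      `|f x - f y| <= mdist x y `^ beta * (g x + g y)) ->
    forall x y Gx Gy, ball_growth m N g x Gx -> ball_growth m N g y Gy ->
      potential_defined f x -> potential_defined f y ->
      `|potential f x - potential f y| <=
        C * mdist x y `^ (alpha + beta) * (Gx + Gy).
Proof.
pose Q := K * 4 `^ N; pose M5 := 9 `^ beta * K * 5 `^ N * (1 + Q * c).
(* The far integrand is of order [t^(alpha - 1) * t^(beta - 1) = t^(- b - 1)], integrable at
   infinity exactly because [b > 0]. *)
pose b := 1 - (alpha + beta).
have Q0 : 0 < Q by rewrite mulr_gt0// powR_gt0.
have M50 : 0 < M5.
  apply: mulr_gt0; last by rewrite addr_gt0// mulr_gt0.
  by rewrite !mulr_gt0// powR_gt0.
have b0 : 0 < b by rewrite subr_gt0.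
have C0 : 0 < 9 `^ beta * Q + M5 * alpha / b.
  by apply: addr_gt0; [rewrite mulr_gt0// powR_gt0|rewrite divr_gt0// mulr_gt0].
exists (9 `^ beta * Q + M5 * alpha / b) => // f g E mf mg g0 nE fg x y Gx Gy gx gy dx dy.
have Gx0 := ball_growth_ge0 gx; have Gy0 := ball_growth_ge0 gy.
pose D := mdist x y.
have [D0|Dgt0] := eqVneq D 0.
  rewrite (mdist_positivity _ _ D0) subrr normr0; apply: mulr_ge0; last exact: addr_ge0.
  by rewrite mulr_ge0 ?powR_ge0// ltW.
have {}Dgt0 : 0 < D by rewrite lt_neqAle eq_sym Dgt0 mdist_ge0.
have beta_ge0 := ltW beta_gt0.
have isx t : 0 < t -> m.-integrable [set: X] (fun z => (s x z t * f z)%:E).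
  by move=> t0; apply: (smooth_integrable m_ball K_gt0 s_ge0 s_bound s_meas beta_ge0 mf mg
    g0 nE fg m_infty t0 gx).
have isy t : 0 < t -> m.-integrable [set: X] (fun z => (s y z t * f z)%:E).
  by move=> t0; apply: (smooth_integrable m_ball K_gt0 s_ge0 s_bound s_meas beta_ge0 mf mg
    g0 nE fg m_infty t0 gy).
have [iVx Ex] := potential_integrableE mf isx dx.
have [iVy Ey] := potential_integrableE mf isy dy.
rewrite -lee_fin -abse_EFin EFinB -Ex -Ey -integralB//.
have iD : mu.-integrable `]0, +oo[
    (fun t => (V t * smooth m s f t x)%:E - (V t * smooth m s f t y)%:E)%E.
  exact: integrableB.
have mD := measurable_int _ iD.
apply: (le_trans (le_abse_integral _ _ mD)) => //.
pose k1 := (9 * D) `^ beta * (Q * (Gx + Gy)).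
pose k2 := M5 * alpha * D * Gy / b.
apply: (@le_trans _ _ (k1 * D `^ alpha + k2 * D `^ (- b))%:E).
  apply: integral_two_powers_le => //.
  - by rewrite mulr_ge0 ?powR_ge0// mulr_ge0 ?(ltW Q0)// addr_ge0.
  - apply: divr_ge0; last exact: ltW.
    by apply: mulr_ge0 => //; apply: mulr_ge0; [apply: mulr_ge0|]; exact: ltW.
  - exact: measurableT_comp.
  - move=> t t0 tD; rewrite -EFinB -mulrBr abse_EFin lee_fin normrM.
    rewrite (ger0_norm (weight_ge0 alpha_gt0 t0)) mulrC.
    apply: ler_pM => //; [exact: weight_ge0| |exact: weight_le0].
    exact: (smooth_diff_near m_ball K_gt0 s_ge0 s_bound s_mass s_meas beta_ge0
      mf mg g0 nE fg m_infty t0 tD (lexx _) gx gy).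
  - move=> t Dt; have t0 : 0 < t by exact: lt_trans Dt.
    rewrite -EFinB -mulrBr abse_EFin lee_fin normrM.
    rewrite (ger0_norm (weight_ge0 alpha_gt0 t0)).
    have far := smooth_diff_far m_ball K_gt0 s_ge0 s_bound s_lipschitz s_mass
      s_meas beta_ge0 mf mg g0 nE fg m_infty t0 (ltW Dt) gx gy.
    apply: (le_trans (ler_pM (weight_ge0 alpha_gt0 t0) _ (weight_le0 alpha_gt0 t0) far)) => //.
    have -> : t `^ (- b - 1) = t `^ (alpha - 1) * t `^ (beta - 1).
      rewrite -powRD; last by apply/implyP => _; rewrite gt_eqF.
      by congr (_ `^ _); rewrite /b; ring.
    by rewrite le_eqVlt; apply/orP; left; apply/eqP; rewrite /k2 -/D -/Q -/M5; field; rewrite gt_eqF.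
rewrite lee_fin /k1 /k2 -/D.
(* [k2] carries the factor [D] of the kernel's Lipschitz bound, and [D * D^(- b) = D^(alpha + beta)]
   matches the near term. *)
have -> : D `^ (- b) = D `^ (alpha + beta) / D.
  rewrite -[X in _ / X](powRr1 (ltW Dgt0)) -powRB; last first.
    by apply/implyP => _; rewrite gt_eqF.
  by congr (_ `^ _); rewrite /b; ring.
rewrite powRM ?(ltW Dgt0)// [D `^ (alpha + beta)]powRD; last first.
  by apply/implyP => _; rewrite gt_eqF.
have DD : 0 <= D `^ alpha * D `^ beta by rewrite mulr_ge0 ?powR_ge0.
have -> : 9 `^ beta * D `^ beta * (Q * (Gx + Gy)) * D `^ alpha +
    M5 * alpha * D * Gy / b * (D `^ alpha * D `^ beta / D) =
    (9 `^ beta * Q * (Gx + Gy) + M5 * alpha / b * Gy) * (D `^ alpha * D `^ beta).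
  by field; rewrite !gt_eqF.
rewrite [leRHS]mulrAC ler_wpM2r// [leRHS]mulrDl lerD2l ler_wpM2l//.
  by rewrite ltW// divr_gt0// mulr_gt0.
by rewrite lerDr.
Qed.

End potential.

(** * Comparison of norms *)

Section Lnorm_lemmas.
Context {R : realType} {d : measure_display} {T : measurableType d}.
Variable m : {measure set T -> \bar R}.

Lemma Lfun_measurableP (p : \bar R) (f : T -> R) :
  f \in Lfun m p <-> measurable_fun [set: T] f /\ ('N[m]_p[EFin \o f] < +oo)%E.
Proof.
rewrite inE/=; split => [/andP[]|[mf Nf]]; rewrite ?inE//=.
apply/andP; split; first by rewrite inE.
by rewrite inE.
Qed.

Lemma Lnorm_ae_le (p : \bar R) (u v : T -> R) (k : R) : (1 < p)%E -> 0 <= k ->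
  measurable_fun [set: T] u -> measurable_fun [set: T] v ->
  (\forall x \ae m, `|u x| <= k * `|v x|) ->
  ('N[m]_p[EFin \o u] <= k%:E * 'N[m]_p[EFin \o v])%E.
Proof.
case: p => [p| |//] p1 k0 mu mv uv; last first.
  rewrite unlock /=; case: ifPn => [_|_]; last by rewrite mule0.
  apply/ess_supP; have := ess_sup_ge m (abse \o (EFin \o v)).
  apply: filterS2 uv => x uvx vx; apply: (@le_trans _ _ (k%:E * `|v x|%:E)%E).
    by rewrite -EFinM lee_fin.
  by apply: lee_wpmul2l; rewrite ?lee_fin.
have p0 : 0 < p by move: p1; rewrite lte_fin; exact: lt_trans.
have i0 (w : T -> R) : (0 <= \int[m]_x (`|w x| `^ p)%:E)%E.
  by apply: integral_ge0 => x _; rewrite lee_fin powR_ge0.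
have mpow (w : T -> R) : measurable_fun [set: T] w ->
    measurable_fun [set: T] (fun x => (`|w x| `^ p)%:E).
  move=> mw; apply/measurable_EFinP; apply: (measurableT_comp (measurable_powR p)).
  by apply: measurableT_comp => //; exact: normr_measurable.
rewrite unlock /=.
apply: (@le_trans _ _ (((k `^ p)%:E * \int[m]_x (`|v x| `^ p)%:E) `^ p^-1)%E).
  apply: gt0_ler_poweR; rewrite ?in_itv/= ?leey ?andbT ?invr_ge0 ?(ltW p0)//.
  - by apply: mule_ge0; [rewrite lee_fin powR_ge0|exact: i0].
  rewrite -ge0_integralZl_EFin//; last 2 first.
  - exact: mpow.
  - exact: powR_ge0.
  apply: ae_ge0_le_integral => //.
  - exact: mpow.
  - by move=> x _; rewrite mule_ge0// lee_fin powR_ge0.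
  - by apply: measurable_funeM; exact: mpow.
  apply: filterS uv => x uvx _; rewrite -EFinM lee_fin -powRM//.
  by apply: ge0_ler_powR => //; rewrite ?nnegrE ?mulr_ge0// ltW.
rewrite poweRM ?poweR_EFin ?lee_fin ?powR_ge0//.
by rewrite -powRrM divff ?gt_eqF// powRr1.
Qed.

End Lnorm_lemmas.

(** * The potential on Hajlasz spaces *)

Section potential_operator.
Context {R : realType} {d : measure_display} {X : borelMetricType d R}.
Variables (m : {sigma_finite_measure set X -> \bar R}) (N c K alpha beta : R).
Variable s : X -> X -> R -> R.
Hypothesis N_gt0 : 0 < N.
Hypothesis c_gt0 : 0 < c.
Hypothesis m_ball : forall (x : X) (r : R), 0 < r ->
  ((c^-1 * r `^ N)%:E <= m (ball x r))%E /\ (m (ball x r) <= (c * r `^ N)%:E)%E.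
Hypothesis K_gt0 : 0 < K.
Hypothesis s_ge0 : forall x z t, 0 < t -> 0 <= s x z t.
Hypothesis s_bound : forall x z t, 0 < t -> s x z t <= K / t `^ N * \1_(ball x (4 * t)) z.
Hypothesis s_lipschitz : forall x y z t, 0 < t ->
  `|s x z t - s y z t| <= K * (mdist x y / t) / t `^ N.
Hypothesis s_mass : forall x t, 0 < t -> (\int[m]_z (s x z t)%:E = 1)%E.
Hypothesis s_meas : measurable_fun [set: (X * X) * R] (fun p => s p.1.1 p.1.2 p.2).
Hypothesis alpha_gt0 : 0 < alpha.
Hypothesis beta_gt0 : 0 < beta.
Hypothesis alpha_beta_lt1 : alpha + beta < 1.
Hypothesis m_infty : m [set: X] = +oo%E.
Notation J := (potential m alpha s).
Notation Mt := (ahlfors_maximal m N).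

Let Mt_ge0 g x : (0 <= Mt g x)%E. Proof. exact: ahlfors_maximal_ge0. Qed.

Let fine_Mt_ge0 g x : 0 <= fine (Mt g x).
Proof. exact/fine_ge0/Mt_ge0. Qed.

Let Mt_growth g x : (Mt g x < +oo)%E -> ball_growth m N g x (fine (Mt g x)).
Proof.
move=> Mfin r r0; rewrite EFinM fineK ?ge0_fin_numE//.
exact: integral_le_ahlfors_maximal.
Qed.

Lemma potential_definedP (f : X -> R) x : measurable_fun [set: X] f ->
  (Mt f x < +oo)%E -> potential_defined m alpha s f x /\
    `|J f x| <= 2 * (K * 4 `^ N) * fine (Mt f x).
Proof.
move=> mf Mfin; have gf := Mt_growth Mfin.
have H := potential_bound K_gt0 s_ge0 s_bound s_meas alpha_gt0 mf gf.
have mk : measurable_fun [set: X] (fun z => ((f z)%:E * kern alpha s x z)%E).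
  exact: measurable_potential_integrand.
have df : potential_defined m alpha s f x.
  by apply/integrableP; split => //; rewrite (le_lt_trans H)// ltry.
split=> //; rewrite -lee_fin /potential -abse_EFin fineK; last first.
  exact: integrable_fin_num.
by apply: (le_trans (le_abse_integral _ _ mk)) => //; rewrite -!mulrA in H *.
Qed.

Lemma potential_maximal_bound : exists2 C : R, 0 < C &
  forall (f g : X -> R), measurable_fun [set: X] f -> hajlasz_gradient m beta f g ->
    (\forall x \ae m, potential_defined m alpha s f x) ->
    ae_pair m (fun x y => (`|J f x - J f y|%:E <=
      (C * mdist x y `^ (alpha + beta))%:E * (Mt g x + Mt g y))%E).
Proof.
have [C C0 HC] := potential_diff_le c_gt0 m_ball K_gt0 s_ge0 s_bound s_lipschitz
  s_mass s_meas alpha_gt0 beta_gt0 alpha_beta_lt1 m_infty.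
exists C => // f g mf [mg g0 [E nE fg]] df.
exists (E `|` ~` [set x | potential_defined m alpha s f x]); first exact: negligibleU.
move=> x y /not_orP[Ex /contrapT dx] /not_orP[Ey /contrapT dy].
(* The diagonal is set aside first: where [Mt g] is infinite the right-hand side is [+oo] only if
   the factor [d(x, y)^(alpha + beta)] is positive. *)
have [->|xy] := eqVneq x y.
  by rewrite subrr normr0 mule_ge0 ?adde_ge0// lee_fin mulr_ge0 ?powR_ge0// ltW.
have D0 : 0 < C * mdist x y `^ (alpha + beta).
  by rewrite mulr_gt0// powR_gt0// mdist_gt0.
have [Mx|Mx] := ltP (Mt g x) +oo%E; last first.
  have -> : Mt g x = +oo%E by apply/eqP; rewrite eq_le leey Mx.
  by rewrite addye ?gt0_muley ?leey ?lte_fin// gt_eqF// (lt_le_trans _ (Mt_ge0 g y))// ltNyr.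
have [My|My] := ltP (Mt g y) +oo%E; last first.
  have -> : Mt g y = +oo%E by apply/eqP; rewrite eq_le leey My.
  by rewrite addey ?gt0_muley ?leey ?lte_fin// gt_eqF// (lt_le_trans _ (Mt_ge0 g x))// ltNyr.
have := HC f g E mf mg g0 nE fg x y _ _ (Mt_growth Mx) (Mt_growth My) dx dy.
by rewrite -lee_fin EFinM EFinD !fineK// ge0_fin_numE.
Qed.

Lemma potential_maximal_function_bound : exists2 C : R, 0 < C &
  forall (f g : X -> R), measurable_fun [set: X] f -> hajlasz_gradient m beta f g ->
    (\forall x \ae m, potential_defined m alpha s f x) ->
    ae_pair m (fun x y => (`|J f x - J f y|%:E <=
      (C * mdist x y `^ (alpha + beta))%:E *
      (maximal_function m g x + maximal_function m g y))%E).
Proof.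
have [C C0 HC] := potential_maximal_bound.
exists (C * c); first exact: mulr_gt0.
move=> f g mf fg df; have [E nE HE] := HC f g mf fg df.
exists E => // x y Ex Ey; apply: (le_trans (HE x y Ex Ey)).
have M_le w : (Mt g w <= c%:E * maximal_function m g w)%E.
  by have [mg _ _] := fg; exact: ahlfors_maximal_le_maximal_function.
have M_ge0 w : (0 <= maximal_function m g w)%E.
  by have := le_trans (Mt_ge0 g w) (M_le w); rewrite pmule_rge0// lte_fin.
rewrite mulrAC [X in (_ <= X * _)%E]EFinM -muleA; apply: lee_wpmul2l.
  by rewrite lee_fin mulr_ge0 ?powR_ge0// ltW.
by rewrite ge0_muleDr//; exact: leeD.
Qed.

Section Lp.
Variable p : \bar R.
Hypothesis p_gt1 : (1 < p)%E.

Lemma Lp_potential_defined (f : X -> R) : f \in Lfun m p ->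
  \forall x \ae m, potential_defined m alpha s f x.
Proof.
move=> /Lfun_measurableP[mf Nf].
have [C C0 HC] := ahlfors_maximal_Lnorm N_gt0 c_gt0 m_ball m_infty p_gt1.
have [Mfin _] := HC f mf Nf; apply: filterS Mfin => x Mx.
by have [] := potential_definedP mf Mx.
Qed.

(** The function [v] leaves room for [J f - J f0], which agrees with [J (f - f0)] only almost
    everywhere. The same holds for the next lemma. *)
Lemma Lp_potential_norm : exists2 C : R, 0 < C & forall f : X -> R, f \in Lfun m p ->
  forall v : X -> R, measurable_fun [set: X] v -> (\forall x \ae m, v x = J f x) ->
    ('N[m]_p[EFin \o v] <= C%:E * 'N[m]_p[EFin \o f])%E.
Proof.
have [C C0 HC] := ahlfors_maximal_Lnorm N_gt0 c_gt0 m_ball m_infty p_gt1.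
have k0 : 0 < 2 * (K * 4 `^ N) by rewrite !mulr_gt0// powR_gt0.
exists (2 * (K * 4 `^ N) * C); first exact: mulr_gt0.
move=> f /Lfun_measurableP[mf Nf] v mv vJ; have [Mfin NM] := HC f mf Nf.
have mM : measurable_fun [set: X] (fine \o Mt f).
  apply: measurableT_comp; first exact: fine_measurable.
  exact: measurable_ahlfors_maximal.
apply: (@le_trans _ _ ((2 * (K * 4 `^ N))%:E * 'N[m]_p[EFin \o (fine \o Mt f)])%E).
  apply: Lnorm_ae_le => //; first exact: ltW.
  apply: filterS2 vJ Mfin => x -> Mx; have [_] := potential_definedP mf Mx.
  by rewrite [ `|(fine \o _) x| ]ger0_norm ?(fine_Mt_ge0 f x).
by rewrite [X in (_ <= X * _)%E]EFinM -muleA; apply: lee_wpmul2l => //; rewrite lee_fin ltW.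
Qed.

Lemma Lp_potential_gradient : exists2 C : R, 0 < C &
  forall u g v : X -> R, u \in Lfun m p -> hajlasz_gradient m beta u g ->
    ('N[m]_p[EFin \o g] < +oo)%E -> (\forall x \ae m, v x = J u x) ->
    exists2 G, hajlasz_gradient m (alpha + beta) v G &
      ('N[m]_p[EFin \o G] <= C%:E * 'N[m]_p[EFin \o g])%E.
Proof.
have [CM CM0 HM] := ahlfors_maximal_Lnorm N_gt0 c_gt0 m_ball m_infty p_gt1.
have [C C0 HC] := potential_maximal_bound.
exists (C * CM); first exact: mulr_gt0.
move=> u g v Lu ug Ng vJ; have [mg g0 _] := ug.
have [Mfin NM] := HM g mg Ng.
have mM : measurable_fun [set: X] (fine \o Mt g).
  apply: measurableT_comp; first exact: fine_measurable.
  exact: measurable_ahlfors_maximal.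
have mG : measurable_fun [set: X] (fun x => C * fine (Mt g x)).
  exact: measurable_funM.
exists (fun x => C * fine (Mt g x)).
  split=> //; first by move=> x; rewrite mulr_ge0 ?fine_Mt_ge0// ltW.
  have [mu _] := (Lfun_measurableP _ _ _).1 Lu.
  have [E nE HE] := HC u g mu ug (Lp_potential_defined Lu).
  exists (E `|` (~` [set x | v x = J u x] `|` ~` [set x | (Mt g x < +oo)%E])).
    by apply: negligibleU => //; exact: negligibleU.
  move=> x y /not_orP[Ex /not_orP[/contrapT/= vx /contrapT/= Mx]].
  move=> /not_orP[Ey /not_orP[/contrapT/= vy /contrapT/= My]].
  have := HE x y Ex Ey; rewrite vx vy -(fineK (x := Mt g x)) ?ge0_fin_numE//.
  rewrite -(fineK (x := Mt g y)) ?ge0_fin_numE// -EFinD -EFinM lee_fin.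
  by rewrite -mulrDr mulrA [C * _]mulrC.
apply: (@le_trans _ _ (C%:E * 'N[m]_p[EFin \o (fine \o Mt g)])%E).
  apply: Lnorm_ae_le => //; first exact: ltW.
  by apply: aeW => x; rewrite normrM gtr0_norm.
by rewrite EFinM -muleA; apply: lee_wpmul2l => //; rewrite lee_fin ltW.
Qed.

Lemma potential_hajlasz_operator : continuous_linear_operator m
  (hajlasz_space m beta p) (hajlasz_norm m beta p)
  (hajlasz_space m (alpha + beta) p) (hajlasz_norm m (alpha + beta) p) J.
Proof.
have [C1 C10 HN] := Lp_potential_norm.
have [C2 C20 HG] := Lp_potential_gradient.
have Lmeas f : f \in Lfun m p -> measurable_fun [set: X] f.
  by move=> /Lfun_measurableP[].
have mJ f : measurable_fun [set: X] f -> measurable_fun [set: X] (J f).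
  exact: measurable_potential.
split.
- move=> f [Lf [g fg Lg]]; have [mf Nf] := (Lfun_measurableP _ _ _).1 Lf.
  have [mg Ng] := (Lfun_measurableP _ _ _).1 Lg.
  have [G fG NG] := HG f g (J f) Lf fg Ng (aeW _ (fun=> erefl)).
  split.
    apply/Lfun_measurableP; split; first exact: mJ.
    apply: (le_lt_trans (HN f Lf (J f) (mJ f mf) (aeW _ (fun=> erefl)))).
    by apply: lte_mul_pinfty => //; rewrite lee_fin ltW.
  exists G => //; apply/Lfun_measurableP; split; first by case: fG.
  by apply: (le_lt_trans NG); apply: lte_mul_pinfty => //; rewrite lee_fin ltW.
- move=> f1 f2 [L1 _] [L2 _] f12; apply: aeW => x.
  exact: (potential_ae_eq s_ge0 s_meas alpha_gt0 x (Lmeas _ L1) (Lmeas _ L2) f12).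
- move=> a f1 f2 [L1 _] [L2 _].
  apply: filterS2 (Lp_potential_defined L1) (Lp_potential_defined L2) => x d1 d2.
  exact: (potential_linear s_ge0 s_meas alpha_gt0 a (Lmeas _ L1) (Lmeas _ L2) d1 d2).
- move=> f0 [L0 _] e e0.
  have C120 : 0 < C1 + C2 by rewrite addr_gt0.
  exists (e / (C1 + C2)); first by rewrite divr_gt0.
  move=> f [Lf _]; set u := (fun x => f x - f0 x); rewrite /hajlasz_norm => Nlt.
  have mu : measurable_fun [set: X] u.
    by apply: measurable_funB; exact: Lmeas.
  have inf_ge0 : (0 <= ereal_inf [set 'N[m]_p[EFin \o g] | g in hajlasz_gradient m beta u])%E.
    by apply: le_ereal_inf_tmp => _ [g _ <-]; exact: Lnorm_ge0.
  have Nu : ('N[m]_p[EFin \o u] < +oo)%E.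
    by rewrite (le_lt_trans _ (lt_trans Nlt (ltry _)))// leeDl.
  have Lu : u \in Lfun m p by apply/Lfun_measurableP.
  have Nu_fin : ('N[m]_p[EFin \o u])%E \is a fin_num by rewrite ge0_fin_numE// Lnorm_ge0.
  (* The infimum over gradients need not be attained. As the norm of [u] is finite, it can be moved
     across the strict inequality, which leaves an actual gradient [g] with the sum of the two norms
     still below the threshold. *)
  move: Nlt; rewrite addeC -lteBrDr// => /ereal_inf_lt[_ [g ug <-]].
  rewrite lteBrDr// => Nlt.
  have Ng : ('N[m]_p[EFin \o g] < +oo)%E.
    by rewrite (le_lt_trans _ (lt_trans Nlt (ltry _)))// leeDl// Lnorm_ge0.
  set v := (fun x => J f x - J f0 x).
  have mv : measurable_fun [set: X] v.
    by apply: measurable_funB; apply: mJ; exact: Lmeas.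
  (* Linearity is applied to [f = 1 * u + f0], at points where both potentials converge. *)
  have vJ : \forall x \ae m, v x = J u x.
    apply: filterS2 (Lp_potential_defined Lu) (Lp_potential_defined L0) => x d1 d2.
    have := potential_linear s_ge0 s_meas alpha_gt0 1 mu (Lmeas _ L0) d1 d2.
    rewrite mul1r (_ : (fun y => 1 * u y + f0 y) = f); last first.
      by apply/funext => y; rewrite mul1r subrK.
    by rewrite /v => ->; rewrite addrK.
  have [G vG NG] := HG u g v Lu ug Ng vJ.
  apply: (@le_lt_trans _ _ ((C1 + C2)%:E * ('N[m]_p[EFin \o g] + 'N[m]_p[EFin \o u]))%E).
    apply: (@le_trans _ _ (C1%:E * 'N[m]_p[EFin \o u] + C2%:E * 'N[m]_p[EFin \o g])%E).
      apply: leeD; first exact: HN.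
      by apply: (le_trans _ NG); apply: ereal_inf_lbound; exists G.
    rewrite ge0_muleDr ?Lnorm_ge0// addeC; apply: leeD; apply: lee_wpmul2r;
      by rewrite ?Lnorm_ge0// lee_fin ?lerDl ?lerDr ltW.
  by rewrite muleC -lte_pdivlMr.
Qed.

End Lp.

End potential_operator.

(** * From the Bessel kernel to the abstract kernel *)

Lemma sigma_finite_measure_of {d : measure_display} {T : measurableType d}
    {R : realType} (m : {measure set T -> \bar R}) : sigma_finite [set: T] m ->
  exists sm : {sigma_finite_measure set T -> \bar R}, m = sm :> {measure set T -> \bar R}.
Proof.
move=> sf.
pose H1 := isSFinite.Build _ _ _ _ (sfinite_measure_sigma_finite sf).
pose H2 := isSigmaFinite.Build _ _ _ _ sf.
pose sm := HB.pack_for (SigmaFiniteMeasure.type T R) (Measure.sort m) H1 H2.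
by exists sm; exact: eq_measure.
Qed.

Section eq_cutoff.
Context {R : realType} {d : measure_display} {X : borelMetricType d R}.
Variables (m : {measure set X -> \bar R}) (N : R) (h1 h2 : R -> R) (t : R).
Hypothesis t_gt0 : 0 < t.
Hypothesis h12 : forall u, 0 <= u -> h1 u = h2 u.

Let hE (u v : X) : h1 (mdist u v / t) = h2 (mdist u v / t).
Proof. by apply: h12; rewrite divr_ge0 ?mdist_ge0// ltW. Qed.

Let approx_idE (F1 F2 : X -> R) u : F1 =1 F2 ->
  approx_id m N h1 t F1 u = approx_id m N h2 t F2 u.
Proof.
move=> F12; rewrite /approx_id; congr (_ * _).
by apply: eq_Rintegral => v _; rewrite hE F12.
Qed.

Let approx_phiE (u : X) : approx_phi m N h1 u t = approx_phi m N h2 u t.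
Proof. by rewrite /approx_phi; congr _^-1; exact: approx_idE. Qed.

Let approx_psiE (u : X) : approx_psi m N h1 u t = approx_psi m N h2 u t.
Proof.
by rewrite /approx_psi; congr _^-1; apply: approx_idE => v; exact: approx_phiE.
Qed.

(** The cutoff is evaluated only at quotients [d / t >= 0], so [h] may be exchanged for its even
    version, which is Lipschitz on the whole line. *)
Lemma eq_approx_kernel (x z : X) :
  approx_kernel m N h1 x z t = approx_kernel m N h2 x z t.
Proof.
have HI : \int[m]_u (h1 (mdist x u / t) * h1 (mdist z u / t) * approx_psi m N h1 u t) =
    \int[m]_u (h2 (mdist x u / t) * h2 (mdist z u / t) * approx_psi m N h2 u t).
  by apply: eq_Rintegral => u _; rewrite !hE approx_psiE.
by rewrite /approx_kernel HI !approx_phiE.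
Qed.

End eq_cutoff.

Section bessel_kernel.
Context {R : realType} {d : measure_display} {X : borelMetricType d R}.
Variables (m : {sigma_finite_measure set X -> \bar R}) (N c L : R) (h h0 : R -> R).
Hypothesis c_gt0 : 0 < c.
Hypothesis m_ball : forall (x : X) (r : R), 0 < r ->
  ((c^-1 * r `^ N)%:E <= m (ball x r))%E /\ (m (ball x r) <= (c * r `^ N)%:E)%E.
Hypothesis h_cutoff : lipschitz_cutoff L h0.
Hypothesis h_h0 : forall u, 0 <= u -> h u = h0 u.

Lemma bessel_kernelE (alpha : R) (x z : X) : 0 < alpha ->
  bessel_kernel m N h alpha x z = kern alpha (approx_kernel m N h0) x z.
Proof.
move=> a0; have ms := measurable_approx_kernel c_gt0 m_ball h_cutoff.
have mst : measurable_fun [set: R] (approx_kernel m N h0 x z).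
  by apply: (measurableT_comp ms (g := pair (x, z))).
have hE : (\int[@lebesgue_measure R]_(t in `]0%R, +oo[)
      (t `^ alpha / (1 + t `^ alpha) ^+ 2 * approx_kernel m N h x z t / t)%:E =
    \int[@lebesgue_measure R]_(t in `]0%R, +oo[)
      (t `^ alpha / (1 + t `^ alpha) ^+ 2 * approx_kernel m N h0 x z t / t)%:E)%E.
  by apply: eq_integral_positive => t t0; rewrite (eq_approx_kernel _ _ t0 h_h0).
have s_ge0 t : 0 < t -> 0 <= approx_kernel m N h0 x z t.
  by move=> t0; exact: (approx_kernel_ge0 c_gt0 m_ball h_cutoff t0 x z).
have W := integral_weightE a0 mst s_ge0.
by rewrite /bessel_kernel hE W.
Qed.

End bessel_kernel.

Theorem proposition3p5 (R : realType) (d : measure_display)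
    (X : borelMetricType d R) (m : {measure set X -> \bar R})
    (N : R) (h : R -> R) (alpha beta : R)
    (m_infty : m [set: X] = +oo%E)
    (N_gt0 : 0 < N) (m_regular : ahlfors_regular m N)
    (h_cutoff : smooth_cutoff h)
    (alpha_gt0 : 0 < alpha) (beta_gt0 : 0 < beta)
    (alpha_beta_lt1 : alpha + beta < 1) :
  (exists2 C : R, 0 < C &
    forall f g : X -> R, measurable_fun [set: X] f ->
      hajlasz_gradient m beta f g ->
      (\forall x \ae m, bessel_defined m N h alpha f x) ->
      ae_pair m (fun x y =>
        (`|bessel_potential m N h alpha f x
           - bessel_potential m N h alpha f y|%:E
         <= (C * mdist x y `^ (alpha + beta))%:E
            * (maximal_function m g x + maximal_function m g y))%E)) /\
  (forall p : \bar R, (1 < p)%E ->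
    (forall f, hajlasz_space m beta p f ->
      \forall x \ae m, bessel_defined m N h alpha f x) /\
    continuous_linear_operator m
      (hajlasz_space m beta p) (hajlasz_norm m beta p)
      (hajlasz_space m (alpha + beta) p) (hajlasz_norm m (alpha + beta) p)
      (bessel_potential m N h alpha)).
Proof.
have [c c_gt0 m_ball] := m_regular.
have [sm mE] := sigma_finite_measure_of (ahlfors_sigma_finite m_regular).
subst m.
have [L L_gt0 hL] := smooth_cutoff_lipschitz h_cutoff.
pose s := approx_kernel sm N (fun u => h `|u|).
pose A := c * 2 `^ N.
have A_gt0 : 0 < A by rewrite mulr_gt0// powR_gt0.
pose K1 := 2 * A ^+ 7 * L + 2 * A ^+ 5 * L.
have K1_gt0 : 0 < K1 by rewrite addr_gt0// !mulr_gt0// exprn_gt0.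
(* A single constant dominating both the size bound and the Lipschitz bound of the kernel. *)
pose K := A ^+ 5 + K1.
have K_gt0 : 0 < K by rewrite addr_gt0// exprn_gt0.
have s_ge0 x z t : 0 < t -> 0 <= s x z t.
  by move=> t0; exact: (approx_kernel_ge0 c_gt0 m_ball hL).
have s_bound x z t : 0 < t -> s x z t <= K / t `^ N * \1_(ball x (4 * t)) z.
  move=> t0; apply: (le_trans (approx_kernel_bound c_gt0 m_ball hL t0 x z)).
  by rewrite ler_wpM2r// ler_wpM2r ?invr_ge0 ?powR_ge0// lerDl ltW.
have s_lipschitz x y z t : 0 < t ->
    `|s x z t - s y z t| <= K * (mdist x y / t) / t `^ N.
  move=> t0; apply: (le_trans (approx_kernel_lipschitz c_gt0 m_ball hL t0 x y z)).
  rewrite ler_wpM2r ?invr_ge0 ?powR_ge0// ler_wpM2r ?divr_ge0 ?mdist_ge0 ?(ltW t0)//.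
  by rewrite lerDr exprn_ge0// ltW.
have s_mass x t : 0 < t -> (\int[sm]_z (s x z t)%:E = 1)%E.
  by move=> t0; exact: (approx_kernel_mass c_gt0 m_ball hL).
have s_meas : measurable_fun [set: (X * X) * R] (fun p => s p.1.1 p.1.2 p.2).
  exact: (measurable_approx_kernel c_gt0 m_ball hL).
have kE x z : bessel_kernel sm N h alpha x z = kern alpha s x z.
  apply: (bessel_kernelE c_gt0 m_ball hL _ x z alpha_gt0) => u u0.
  by rewrite ger0_norm.
have JE : bessel_potential sm N h alpha = potential sm alpha s.
  apply/funext => f; apply/funext => x; rewrite /bessel_potential /potential.
  by congr fine; apply: eq_integral => z _; rewrite kE.
have dE f x : bessel_defined sm N h alpha f x = potential_defined sm alpha s f x.
  rewrite /bessel_defined /potential_defined; congr (is_true (_.-integrable _ _)).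
  by apply/funext => z; rewrite kE.
(* The kernel is generalized here: what follows depends on its listed properties and no longer on
   its formula. *)
rewrite JE; move: s s_ge0 s_bound s_lipschitz s_mass s_meas kE JE dE.
move=> s s_ge0 s_bound s_lipschitz s_mass s_meas _ _ dE.
split.
  have [C C0 HC] := potential_maximal_function_bound c_gt0 m_ball K_gt0 s_ge0 s_bound
    s_lipschitz s_mass s_meas alpha_gt0 beta_gt0 alpha_beta_lt1 m_infty.
  exists C => // f g mf fg df; apply: HC => //.
  by apply: filterS df => x; rewrite dE.
move=> p p_gt1; split=> [f [Lf _]|].
  have := Lp_potential_defined N_gt0 c_gt0 m_ball K_gt0 s_ge0 s_bound s_meas
    alpha_gt0 m_infty p_gt1 Lf.
  by apply: filterS => x; rewrite dE.
exact: (potential_hajlasz_operator N_gt0 c_gt0 m_ball K_gt0 s_ge0 s_bound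
  s_lipschitz s_mass s_meas alpha_gt0 beta_gt0 alpha_beta_lt1 m_infty p_gt1).
Qed.
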